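(* Let $G$ and $H$ be undirected simple graphs on $N=\{1,\dots,n\}$ with $|E_G\cap E_H|=3$, such that the edges of $E_G\cap E_H$ form a connected graph on the set of vertices incident to them. If $E_G\cap E_H=\{ij,ik,jk\}$ forms a $3$-clique, then $\mathcal M(G,H)=\mathrm{PD}_{ijk}$ (padded, see context). Otherwise, with distinct $i,j,k,l$, either $E_G\cap E_H=\{ij,jk,kl\}$ forms a path or $E_G\cap E_H=\{ij,ik,il\}$ is a star. Up to swapping $G$ and $H$ (which replaces the model by the set of inverses), one can restrict to the case where $H|_{ijkl}$ has at least as many non-edges as $G|_{ijkl}$; one can moreover restrict to $n=4$ and assume $(i,j,k,l)=(1,2,3,4)$. Write $K=E_{K_{1234}}$ for the set of all six edges on $\{1,2,3,4\}$. **Path.** If $E_G\cap E_H=\{12,23,34\}$, then up to symmetry (relabeling vertices) and inversion we have the following cases: (1) $E_H=E_G\cap E_H$, $E_G=K$: $\mathcal M(G,H)=\mathcal M(G\cap H)^{-1}$. (2) $E_H=E_G\cap E_H$, $E_G=K\setminus\{13\}$: $\mathcal M(G,H)=(\mathrm{PD}_{12}\oplus\mathrm{PD}_{34})\cup\mathcal M(\{23,34\})^{-1}$. (3) $E_H=E_G\cap E_H$, $E_G=K\setminus\{14\}$: $\mathcal M(G,H)=(\mathrm{PD}_{12}\oplus\mathrm{PD}_{34})\cup\mathcal M(\{12,23\})^{-1}\cup\mathcal M(\{23,34\})^{-1}$. (4) $E_H=E_G\cap E_H$, $E_G=K\setminus\{13,14\}$: $\mathcal M(G,H)$ is as in case (3),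 i.e. $\mathcal M(G,H)=(\mathrm{PD}_{12}\oplus\mathrm{PD}_{34})\cup\mathcal M(\{12,23\})^{-1}\cup\mathcal M(\{23,34\})^{-1}$. (5) $E_H=E_G\cap E_H$, $E_G=K\setminus\{13,24\}$: $\mathcal M(G,H)=(\mathrm{PD}_{12}\oplus\mathrm{PD}_{34})\cup\mathrm{PD}_{23}$. (6) $E_G=E_H=E_G\cap E_H$: $\mathcal M(G,H)$ is as in case (5), i.e. $\mathcal M(G,H)=(\mathrm{PD}_{12}\oplus\mathrm{PD}_{34})\cup\mathrm{PD}_{23}$. (7) $E_H=(E_G\cap E_H)\cup\{13\}$, $E_G=K\setminus\{13\}$: $$\mathcal M_1(G,H)=\left\{\begin{pmatrix}1&\sigma_{12}&\sigma_{12}\sigma_{23}&0\\ \sigma_{12}&1&\sigma_{23}&0\\ \sigma_{12}\sigma_{23}&\sigma_{23}&1&\sigma_{34}\\ 0&0&\sigma_{34}&1\end{pmatrix}:\sigma_{12}\in(-1,1),\ \sigma_{23}^2+\sigma_{34}^2<1\right\}.$$ (8) $E_H=(E_G\cap E_H)\cup\{13\}$, $E_G=K\setminus\{13,14\}$: $\mathcal M_1(G,H)$ is the same set as in (7). (9) $E_H=(E_G\cap E_H)\cup\{13\}$, $E_G=K\setminus\{13,24\}$: $$\mathcal M_1(G,H)=(\mathrm{PD}_{\{12\},1}\oplus\mathrm{PD}_{\{34\},1})\cup\left\{\begin{pmatrix}1&\sigma_{12}&\sigma_{12}\sigma_{23}&0\\ \sigma_{12}&1&\sigma_{23}&0\\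 \sigma_{12}\sigma_{23}&\sigma_{23}&1&0\\ 0&0&0&1\end{pmatrix}:\sigma_{12},\sigma_{23}\in(-1,1)\right\}.$$ (10) $E_H=(E_G\cap E_H)\cup\{14\}$, $E_G=K\setminus\{14\}$: $$\mathcal M_1(G,H)=\left\{\begin{pmatrix}1&\sigma_{12}&0&\frac{-\sigma_{12}\sigma_{23}\sigma_{34}}{1-\sigma_{23}^2}\\ \sigma_{12}&1&\sigma_{23}&0\\ 0&\sigma_{23}&1&\sigma_{34}\\ \frac{-\sigma_{12}\sigma_{23}\sigma_{34}}{1-\sigma_{23}^2}&0&\sigma_{34}&1\end{pmatrix}:\sigma_{12}^2+\sigma_{23}^2<1,\ \sigma_{23}^2+\sigma_{34}^2<1\right\}.$$ (11) $E_H=(E_G\cap E_H)\cup\{14\}$, $E_G=K\setminus\{13,14\}$: $$\mathcal M_1(G,H)=(\mathrm{PD}_{\{12\},1}\oplus\mathrm{PD}_{\{34\},1})\cup\left\{\begin{pmatrix}1&0&0&0\\0&1&\sigma_{23}&0\\0&\sigma_{23}&1&\sigma_{34}\\0&0&\sigma_{34}&1\end{pmatrix}:\sigma_{23}^2+\sigma_{34}^2<1\right\}.$$ **Star.** If $E_G\cap E_H=\{12,13,14\}$, then up to symmetry and inversion we have the following cases: (1) $E_H=E_G\cap E_H$, $E_G=K$: $\mathcal M(G,H)=\mathcal M(G\cap H)^{-1}$. (2) $E_H=E_G\cap E_H$, $E_G=K\setminus\{23\}$: $$\mathcal M_1(G,H)=\left\{\begin{pmatrix}1&0&\sigma_{13}&\sigma_{14}\\0&1&0&0\\\sigma_{13}&0&1&0\\\sigma_{14}&0&0&1\end{pmatrix}:\sigma_{13}^2+\sigma_{14}^2<1\right\}\cup\left\{\begin{pmatrix}1&\sigma_{12}&0&\sigma_{14}\\\sigma_{12}&1&0&0\\0&0&1&0\\\sigma_{14}&0&0&1\end{pmatrix}:\sigma_{12}^2+\sigma_{14}^2<1\right\},$$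 a union of two discs intersecting in a line segment. (3) $E_H=(E_G\cap E_H)\cup\{23\}$, $E_G=K\setminus\{23\}$: $$\mathcal M_1(G,H)=\left\{\begin{pmatrix}1&\sigma_{12}&\sigma_{13}&\sigma_{14}\\\sigma_{12}&1&\frac{\sigma_{12}\sigma_{13}}{1-\sigma_{14}^2}&0\\\sigma_{13}&\frac{\sigma_{12}\sigma_{13}}{1-\sigma_{14}^2}&1&0\\\sigma_{14}&0&0&1\end{pmatrix}\in\mathrm{PD}_4\right\}.$$ (4) $E_H=E_G\cap E_H$, $E_G=K\setminus\{23,24\}$: $$\mathcal M_1(G,H)=\left\{\begin{pmatrix}1&\sigma_{12}&0&0\\\sigma_{12}&1&0&0\\0&0&1&0\\0&0&0&1\end{pmatrix}:\sigma_{12}\in(-1,1)\right\}\cup\left\{\begin{pmatrix}1&0&\sigma_{13}&\sigma_{14}\\0&1&0&0\\\sigma_{13}&0&1&0\\\sigma_{14}&0&0&1\end{pmatrix}:\sigma_{13}^2+\sigma_{14}^2<1\right\}.$$ (5) $E_H=(E_G\cap E_H)\cup\{23\}$, $E_G=K\setminus\{23,24\}$: $$\mathcal M_1(G,H)=\left\{\begin{pmatrix}1&\sigma_{12}&\sigma_{13}&0\\\sigma_{12}&1&\sigma_{12}\sigma_{13}&0\\\sigma_{13}&\sigma_{12}\sigma_{13}&1&0\\0&0&0&1\end{pmatrix}:\sigma_{12},\sigma_{13}\in(-1,1)\right\}\cup\left\{\begin{pmatrix}1&0&\sigma_{13}&\sigma_{14}\\0&1&0&0\\\sigma_{13}&0&1&0\\\sigma_{14}&0&0&1\end{pmatrix}:\sigma_{13}^2+\sigma_{14}^2<1\right\}.$$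 (6) $E_G=E_H=E_G\cap E_H$: $\mathcal M_1(G,H)$ is the union of the three coordinate line segments (through the identity matrix) parametrized by $\sigma_{12}$, $\sigma_{13}$ and $\sigma_{14}$, respectively, each ranging over $(-1,1)$.
   Context: $E_G$ denotes the edge set of $G$; $G\cap H$ is the graph on $N$ with edge set $E_G\cap E_H$; $G|_V$ is the induced subgraph on $V\subseteq N$; index sets are written by juxtaposition, e.g. $ijk=\{i,j,k\}$. For a finite set $V$, $\mathrm{PD}_V$ is the set of real symmetric positive definite matrices with rows and columns indexed by $V$, $\mathrm{PD}_{V,1}$ its subset of matrices with ones on the diagonal, and $\mathrm{PD}_n=\mathrm{PD}_N$. For a graph $F$ on vertex set $V$ (possibly given by its edge set), $\mathcal M(F)=\{\Sigma\in\mathrm{PD}_V:(\Sigma^{-1})_{st}=0\text{ for all }s\neq t,\ st\notin E_F\}$ and $\mathcal M(F)^{-1}=\{\Sigma^{-1}:\Sigma\in\mathcal M(F)\}=\{\Sigma\in\mathrm{PD}_V:\Sigma_{st}=0\text{ for all }s\ne t,\ st\notin E_F\}$. For graphs $G,H$ on $V$, $\mathcal M(G,H)=\mathcal M(G)\cap\mathcal M(H)^{-1}$, and $\mathcal M_1(G,H)$ is the subset of matrices in $\mathcal M(G,H)$ with all diagonal entries $1$. In the classification with $n=4$, sets such as $\mathcal M(\{23,34\})^{-1}$ refer to the graph on $\{1,2,3,4\}$ with the given edge set. $\oplus$ denotes the set of block-diagonal matrices with diagonal blocks in the given sets, indexed by the given disjoint index sets. Padding convention: when a set of matrices indexed by a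 proper subset $V\subset N$ is said to equal (or be a part of) $\mathcal M(G,H)$, it denotes the set of block-diagonal matrices in $\mathrm{PD}_N$ whose $V$-block lies in the given set and which are diagonal with arbitrary positive diagonal entries on $N\setminus V$, all other entries being zero; the restriction to $n=4$ is meant in this sense. Relabeling vertices permutes rows and columns simultaneously, and $\mathcal M(H,G)=\{\Sigma^{-1}:\Sigma\in\mathcal M(G,H)\}$.
   Formalization: In Path case (4) the set M({12,23})^{-1} is dropped, so the model is as in case (2), not (3): the printed equality is false, e.g. for unit diagonal, σ12=σ23=1/2 and other entries 0, where (Σ^{-1})_13≠0 although 13 is a non-edge of G. *)

(* Defs.v *)
(* MathComp, with classical sets of matrices over a realType. *)
From mathcomp Require Export all_boot all_order all_algebra.
From mathcomp Require Export classical_sets reals.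
Set Implicit Arguments.
Unset Strict Implicit.
Unset Printing Implicit Defensive.
Import Order.TTheory GRing.Theory Num.Theory.
Local Open Scope ring_scope.

(* A graph on the vertex set 'I_n is given by its edge set; the intersection
   of two graphs is then the intersection G :&: H of the edge sets. *)
Definition simple_graph n (G : {set {set 'I_n}}) : Prop :=
  forall e, e \in G -> #|e| = 2%N.

Definition edge n (i j : 'I_n) : {set 'I_n} := [set i; j]%SET.

Definition complete_graph n : {set {set 'I_n}} :=
  [set e : {set 'I_n} | #|e| == 2%N]%SET.

Definition triangle n (i j k : 'I_n) : {set {set 'I_n}} :=
  [set edge i j; edge i k; edge j k]%SET.

Definition path_graph n (i j k l : 'I_n) : {set {set 'I_n}} :=
  [set edge i j; edge j k; edge k l]%SET.

Definition star_graph n (i j k l : 'I_n) : {set {set 'I_n}} :=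
  [set edge i j; edge i k; edge i l]%SET.

(* Only the vertices incident to some edge, i.e. those in cover F, matter. *)
Definition connected_on_support n (F : {set {set 'I_n}}) : Prop :=
  forall s t, s \in finset.cover F -> t \in finset.cover F ->
    connect [rel x y | edge x y \in F] s t.

(* An ordered index set of size m is a duplicate-free V : m.-tuple 'I_n.
   The subgraph induced on V is transported to 'I_m along tnth V, and so is
   the V-block of a matrix. *)
Definition induced n m (V : m.-tuple 'I_n) (G : {set {set 'I_n}}) :
    {set {set 'I_m}} :=
  [set e : {set 'I_m} | #|e| == 2%N & (tnth V @: e)%SET \in G]%SET.

Definition nonedges n (G : {set {set 'I_n}}) : {set {set 'I_n}} :=
  complete_graph n :\: G.

Section Models.
Variable R : realType.

Definition PD n : set 'M[R]_n :=
  [set S | S^T = S /\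
    forall x : 'rV[R]_n, x != 0 -> 0 < (x *m S *m x^T) 0 0]%classic.

Definition PD1 n : set 'M[R]_n :=
  [set S | PD S /\ forall i, S i i = 1]%classic.

Definition block n m (V : m.-tuple 'I_n) (S : 'M[R]_n) : 'M[R]_m :=
  mxsub (tnth V) (tnth V) S.

(* The diagonal entries outside V are arbitrary positive: their positivity is
   part of PD. *)
Definition padded n m (V : m.-tuple 'I_n) (X : set 'M[R]_m) : set 'M[R]_n :=
  [set S | [/\ PD S, X (block V S) &
    forall s t, s != t -> ~~ ((s \in V) && (t \in V)) -> S s t = 0]]%classic.

Definition direct_sum n p q (U : p.-tuple 'I_n) (V : q.-tuple 'I_n)
    (X : set 'M[R]_p) (Y : set 'M[R]_q) : set 'M[R]_n :=
  [set S | [/\ X (block U S), Y (block V S) &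
    forall s t, ~~ ((s \in U) && (t \in U)) -> ~~ ((s \in V) && (t \in V)) ->
      S s t = 0]]%classic.

Definition inverses n (X : set 'M[R]_n) : set 'M[R]_n :=
  [set invmx S | S in X]%classic.

(* M(F) *)
Definition markov n (F : {set {set 'I_n}}) : set 'M[R]_n :=
  [set S | PD S /\
    forall s t, s != t -> edge s t \notin F -> invmx S s t = 0]%classic.

(* M(F)^{-1} *)
Definition markov_inv n (F : {set {set 'I_n}}) : set 'M[R]_n :=
  inverses (markov F).

(* M(G, H) *)
Definition double_markov n (G H : {set {set 'I_n}}) : set 'M[R]_n :=
  (markov G `&` markov_inv H)%classic.

(* M_1(G, H) *)
Definition double_markov1 n (G H : {set {set 'I_n}}) : set 'M[R]_n :=
  [set S | double_markov G H S /\ forall i, S i i = 1]%classic.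

Definition mx4 (rows : seq (seq R)) : 'M[R]_4 :=
  \matrix_(i < 4, j < 4) nth 0 (nth [::] rows i) j.

(* Up to swapping G and H and reordering the vertices s, the pair (G, H)
   restricted to s is one of the pairs (E_G, E_H) of L, where H has at least
   as many non-edges as G on s, and the model is the padding of the
   corresponding model on four vertices. *)
Definition reduces_to n (G H : {set {set 'I_n}}) (s : seq 'I_n)
    (L : seq ({set {set 'I_4}} * {set {set 'I_4}})) : Prop :=
  exists (V : 4.-tuple 'I_n) (G' H' : {set {set 'I_n}}),
    [/\ perm_eq V s,
        (G', H') = (G, H) \/ (G', H') = (H, G),
        (#|nonedges (induced V G')| <= #|nonedges (induced V H')|)%N,
        double_markov G' H' =
          padded V (double_markov (induced V G') (induced V H')) &
        (induced V G', induced V H') \in L].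

End Models.

Arguments PD R n : clear implicits.
Arguments PD1 R n : clear implicits.
Arguments markov R {n} F.
Arguments markov_inv R {n} F.
Arguments double_markov R {n} G H.
Arguments double_markov1 R {n} G H.
Arguments reduces_to R {n} G H s L.

Definition v1 : 'I_4 := @Ordinal 4 0 isT.
Definition v2 : 'I_4 := @Ordinal 4 1 isT.
Definition v3 : 'I_4 := @Ordinal 4 2 isT.
Definition v4 : 'I_4 := @Ordinal 4 3 isT.

Definition e12 := edge v1 v2.
Definition e13 := edge v1 v3.
Definition e14 := edge v1 v4.
Definition e23 := edge v2 v3.
Definition e24 := edge v2 v4.
Definition e34 := edge v3 v4.

Definition K4 : {set {set 'I_4}} := [set e12; e13; e14; e23; e24; e34]%SET.
Definition P4 : {set {set 'I_4}} := path_graph v1 v2 v3 v4.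
Definition S4 : {set {set 'I_4}} := star_graph v1 v2 v3 v4.

(* Pairs (E_G, E_H). *)
Definition path_cases : seq ({set {set 'I_4}} * {set {set 'I_4}}) :=
  [:: (K4, P4);
      (K4 :\ e13, P4);
      (K4 :\ e14, P4);
      (K4 :\: [set e13; e14], P4);
      (K4 :\: [set e13; e24], P4);
      (P4, P4);
      (K4 :\ e13, e13 |: P4);
      (K4 :\: [set e13; e14], e13 |: P4);
      (K4 :\: [set e13; e24], e13 |: P4);
      (K4 :\ e14, e14 |: P4);
      (K4 :\: [set e13; e14], e14 |: P4)]%SET.

Definition star_cases : seq ({set {set 'I_4}} * {set {set 'I_4}}) :=
  [:: (K4, S4);
      (K4 :\ e23, S4);
      (K4 :\ e23, e23 |: S4);
      (K4 :\: [set e23; e24], S4);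
      (K4 :\: [set e23; e24], e23 |: S4);
      (S4, S4)]%SET.

(* Main.v *)
(* If a vertex v is isolated in the intersection of G and H, then each summand of
   sum_(t <> v) K_vt S_tv vanishes, where K is the inverse of S, so K_vv S_vv = 1.
   This is the equality case of the Cauchy-Schwarz inequality
   1 <= (e_v S e_v^T) (e_v K e_v^T), and forces the v-th rows of S and K to be
   multiples of e_v. Hence only the vertices of the intersection matter.
   On four vertices Cramer's rule turns K_st = 0 into the vanishing of the
   3 x 3 minor of S with rows s, u, v and columns t, u, v; in each case this
   polynomial factors, modulo positive principal minors of S, into a product of
   entries or into an equation that determines one entry. Positivity of the
   parametrized matrices follows by writing their quadratic forms as sums of
   squares. *)
Require Import Defs.
From mathcomp Require Import zify ring lra.
Set Implicit Arguments.
Unset Strict Implicit.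
Unset Printing Implicit Defensive.
Import Order.TTheory GRing.Theory Num.Theory.
Local Open Scope classical_set_scope.
Local Open Scope ring_scope.

(** Exhaustiveness is a finite check. Each of the three pairs of [i, j, k, l] outside the
    intersection lies in neither graph, only in [G] or only in [H], which leaves 27 configurations.
    These are compared with the lists modulo swapping [G] and [H] and modulo the automorphisms of
    the intersection: reversal of the path, or the six orders of the leaves of the star. Sets of
    sets do not compute well, so graphs are compared through incidence vectors. When [H] is the
    intersection itself, every relevant minor is a monomial in the entries up to a positive factor,
    so each model is a union of coordinate pieces and the set equality is a Boolean identity in the
    conditions [S s t == 0]. An extra edge of [H] admits an entry tied to the others by an equation.
    If two minors must vanish at once, one is a multiple of the other, or eliminating a monomial
    between them leaves one entry times a factor that positive definiteness keeps nonzero. *)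

Lemma edgeC n (i j : 'I_n) : edge i j = edge j i.
Proof. exact: finset.setUC. Qed.

Lemma edge_eq n (i j k l : 'I_n) :
  (edge i j == edge k l) = (i == k) && (j == l) || (i == l) && (j == k).
Proof.
apply/eqP/idP => [/finset.setP E|]; last first.
  by case/orP=> /andP[/eqP-> /eqP->] //; rewrite edgeC.
move: (E i) (E j) (E k) (E l); rewrite !inE !eqxx ?orbT /=.
rewrite (eq_sym k i) (eq_sym k j) (eq_sym l i) (eq_sym l j).
by do 4!case: eqP => //= _.
Qed.

(** * Positive definite matrices: principal minors, blocks, isolated vertices *)

Section PositiveDefinite.
Variable R : realType.

Lemma PD_sym n (S : 'M[R]_n) s t : PD R n S -> S s t = S t s.
Proof. by case=> symS _; rewrite -{1}symS mxE. Qed.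

Lemma PD_unit n (S : 'M[R]_n) : PD R n S -> S \in unitmx.
Proof.
case=> _ posS; rewrite unitmxE unitfE; apply/det0P => -[x x0 xS].
by have := posS _ x0; rewrite xS mul0mx mxE ltxx.
Qed.

(** The form of [invmx S] at [x] is the form of [S] at [x *m invmx S]. *)
Lemma PD_inv n (S : 'M[R]_n) : PD R n S -> PD R n (invmx S).
Proof.
move=> PDS; have uS := PD_unit PDS; have [symS posS] := PDS.
split=> [|x x0]; first by rewrite trmx_inv symS.
have y0 : x *m invmx S != 0.
  by apply: contra_neq x0 => y0; rewrite -(mulmxKV uS x) y0 mul0mx.
by have := posS _ y0; rewrite mulmxKV // trmx_mul trmx_inv symS mulmxA.
Qed.

Lemma PD_diag_gt0 n (S : 'M[R]_n) s : PD R n S -> 0 < S s s.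
Proof.
case=> _ posS; have := posS (delta_mx 0 s).
rewrite trmx_delta -rowE -colE !mxE; apply.
by apply/eqP => /rowP/(_ s)/eqP; rewrite !mxE !eqxx oner_eq0.
Qed.

(** Bilinearity lets [bformE] expand the quadratic form at a combination of unit vectors into
    entries of [S]. *)
Definition bform n (S : 'M[R]_n) (x y : 'rV[R]_n) : R := (x *m S *m y^T) 0 0.

Lemma bformDl n (S : 'M[R]_n) x y z :
  bform S (x + y) z = bform S x z + bform S y z.
Proof. by rewrite /bform !mulmxDl mxE. Qed.

Lemma bformDr n (S : 'M[R]_n) x y z :
  bform S z (x + y) = bform S z x + bform S z y.
Proof. by rewrite /bform linearD mulmxDr mxE. Qed.

Lemma bformZl n (S : 'M[R]_n) a x y : bform S (a *: x) y = a * bform S x y.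
Proof. by rewrite /bform -!scalemxAl mxE. Qed.

Lemma bformZr n (S : 'M[R]_n) a x y : bform S x (a *: y) = a * bform S x y.
Proof. by rewrite /bform linearZ -scalemxAr mxE. Qed.

Lemma bform_delta n (S : 'M[R]_n) s t :
  bform S (delta_mx 0 s) (delta_mx 0 t) = S s t.
Proof. by rewrite /bform trmx_delta -rowE -colE !mxE. Qed.

Definition bformE := (bformDl, bformDr, bformZl, bformZr, bform_delta).

(** For symmetric [S], the determinant of the principal block on [s], [t], [u]. *)
Definition minor3 n (S : 'M[R]_n) s t u : R :=
  S s s * (S t t * S u u - S t u ^+ 2) - S s t ^+ 2 * S u u
  + 2 * S s t * S s u * S t u - S s u ^+ 2 * S t t.

(** The test vector is the second column of the adjugate of the block; the form takes there the
    value [S s s] times the minor. *)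
Lemma PD_minor2 n (S : 'M[R]_n) s t :
  s != t -> PD R n S -> 0 < S s s * S t t - S s t ^+ 2.
Proof.
move=> st PDS; have Sss := PD_diag_gt0 s PDS; have [_ posS] := PDS.
have := posS ((- S s t) *: delta_mx 0 s + S s s *: delta_mx 0 t).
rewrite -/(bform _ _ _) !bformE (PD_sym t s PDS) => pos.
rewrite -(pmulr_rgt0 _ Sss).
have x0 : - S s t *: delta_mx 0 s + S s s *: delta_mx 0 t != 0 :> 'rV_n.
  apply/eqP => /rowP/(_ t)/eqP; rewrite !mxE !eqxx (eq_sym t) (negPf st) /=.
  by rewrite mulr0 add0r mulr1 gt_eqF.
have := pos x0; lra.
Qed.

(* The quadratic form at the third column of the adjugate of the block. *)
Lemma PD_minor3 n (S : 'M[R]_n) s t u :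
  uniq [:: s; t; u] -> PD R n S -> 0 < minor3 S s t u.
Proof.
rewrite /= !inE negb_or andbT => /andP[/andP[st su] tu] PDS.
have d0 := PD_minor2 st PDS; have [_ posS] := PDS.
pose a := S s t * S t u - S s u * S t t; pose b := S s t * S s u - S s s * S t u.
pose c := S s s * S t t - S s t ^+ 2.
have x0 : a *: delta_mx 0 s + b *: delta_mx 0 t + c *: delta_mx 0 u != 0 :> 'rV_n.
  apply/eqP => /rowP/(_ u)/eqP; rewrite !mxE !eqxx !(eq_sym u).
  by rewrite (negPf su) (negPf tu) /= !mulr0 !add0r mulr1 gt_eqF.
have := posS _ x0; rewrite -/(bform _ _ _) !bformE.
rewrite (PD_sym t s PDS) (PD_sym u s PDS) (PD_sym u t PDS) => pos.
rewrite -(pmulr_rgt0 _ d0); apply: lt_le_trans pos _.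
by rewrite le_eqVlt; apply/orP; left; apply/eqP; rewrite /minor3 /a /b /c; ring.
Qed.

Lemma mulmxV_entry n (S : 'M[R]_n) s t : PD R n S ->
  \sum_u invmx S s u * S u t = (s == t)%:R.
Proof. by move=> /PD_unit/mulVmx/matrixP/(_ s t); rewrite !mxE. Qed.

(** If the rows of [P] are the unit vectors at the vertices of [V], the block is [P S P^T]. As [V]
    has no repetition, [x P] carries the coordinates of [x] at distinct positions and is nonzero
    with [x]. *)
Lemma PD_block n m (V : m.-tuple 'I_n) (S : 'M[R]_n) :
  uniq V -> PD R n S -> PD R m (block V S).
Proof.
move=> uV [symS posS]; split=> [|x x0]; first by rewrite trmx_mxsub symS.
have injV : injective (tnth V) by apply/tuple_uniqP.
pose P : 'M[R]_(m, n) := rowsub (tnth V) 1%:M.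
have PE : block V S = P *m S *m P^T.
  rewrite trmx_mxsub trmx1 mul_rowsub_mx mul1mx mulmx_colsub mulmx1.
  by apply/matrixP => i j; rewrite !mxE.
have y0 : x *m P != 0.
  apply: contra_neq x0 => /rowP y0; apply/rowP => i; rewrite mxE.
  have := y0 (tnth V i); rewrite !mxE => <-; rewrite (bigD1 i) //= big1.
    by rewrite addr0 !mxE eqxx mulr1.
  by move=> j ji; rewrite !mxE (inj_eq injV) (negPf ji) mulr0.
by have := posS _ y0; rewrite PE trmx_mul !mulmxA.
Qed.

(* [z := S_vv K_v - e_v] has [z S z^T = S_vv (S_vv K_vv - 1) = 0]. *)
Lemma PD_isolated n (S : 'M[R]_n) v : PD R n S ->
  (forall t, t != v -> invmx S v t * S t v = 0) ->
  forall t, t != v -> S v t = 0.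
Proof.
move=> PDS iso t tv; have uS := PD_unit PDS; have [symS posS] := PDS.
have Kv : invmx S v v * S v v = 1.
  have := mulmxV_entry v v PDS; rewrite eqxx (bigD1 v) //= big1 ?addr0 //.
have symK : (invmx S)^T = invmx S by rewrite trmx_inv symS.
pose e : 'rV[R]_n := delta_mx 0 v; pose z := S v v *: (e *m invmx S) - e.
have zS : z *m S = S v v *: e - e *m S.
  by rewrite /z mulmxBl -scalemxAl mulmxKV.
have z0 : z = 0.
  apply/eqP; apply: contraT => /posS; rewrite zS.
  suff -> : ((S v v *: e - e *m S) *m z^T) 0 0 = 0 by rewrite ltxx.
  rewrite /z linearB linearZ /= trmx_mul symK mulmxBr -scalemxAr mulmxBl.
  rewrite (mulmxA (e *m S)) mulmxK // mulmxBl -!scalemxAl mulmxA trmx_delta.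
  rewrite -!rowE -!colE !mxE !eqxx /=.
  by rewrite mulr1 subrr subr0 [S v v * invmx _ _ _]mulrC Kv subrr mulr0.
(* With [z = 0], the entry at [t] of [zS] reads [0 = - S v t]. *)
have := congr1 (fun w : 'rV_n => w 0 t) zS.
rewrite z0 mul0mx -rowE !mxE eqxx (negPf tv) /= mulr0 add0r.
by move/eqP; rewrite eq_sym oppr_eq0 => /eqP.
Qed.

End PositiveDefinite.

(** * Models as patterns of zeros, and padding *)

Lemma card_edge n (s t : 'I_n) : (#|edge s t| == 2%N) = (s != t).
Proof. by rewrite cards2; case: (s != t). Qed.

Lemma mem_induced n m (V : m.-tuple 'I_n) (G : {set {set 'I_n}}) s t :
  s != t -> (edge s t \in induced V G) = (edge (tnth V s) (tnth V t) \in G).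
Proof. by move=> st; rewrite inE card_edge st imsetU !imset_set1. Qed.

Section DoubleMarkov.
Variable R : realType.

Definition zero_off n (F : {set {set 'I_n}}) (A : 'M[R]_n) :=
  forall s t, s != t -> edge s t \notin F -> A s t = 0.

Lemma markov_invP n (F : {set {set 'I_n}}) (S : 'M[R]_n) :
  markov_inv R F S <-> PD R n S /\ zero_off F S.
Proof.
split=> [[T [PDT zT] <-]|[PDS zS]]; first by split; [apply: PD_inv|].
exists (invmx S); last exact: invmxK.
by split; [apply: PD_inv|rewrite invmxK].
Qed.

Lemma double_markovP n (G H : {set {set 'I_n}}) (S : 'M[R]_n) :
  double_markov R G H S <->
  [/\ PD R n S, zero_off H S & zero_off G (invmx S)].
Proof.
split=> [[[PDS zK] /markov_invP[_ zS]] //|[PDS zS zK]].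
by split=> //; apply/markov_invP.
Qed.

Lemma double_markovC n (G H : {set {set 'I_n}}) :
  double_markov R H G = inverses (double_markov R G H).
Proof.
apply/seteqP; split=> [S /double_markovP[PDS zS zK]|_ [S /double_markovP[PDS zS zK] <-]].
  exists (invmx S); last exact: invmxK.
  by apply/double_markovP; split=> //; [apply: PD_inv|rewrite invmxK].
by apply/double_markovP; split=> //; [apply: PD_inv|rewrite invmxK].
Qed.

Definition diagonal_off n m (V : m.-tuple 'I_n) (S : 'M[R]_n) :=
  forall s t, s != t -> ~~ ((s \in V) && (t \in V)) -> S s t = 0.

(** [PD_isolated] is applied to [invmx S], whose inverse [S] vanishes off the diagonal in the row of
    a vertex outside [V]. No permutation into block form is involved. *)
Lemma diagonal_off_inv n m (V : m.-tuple 'I_n) (S : 'M[R]_n) :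
  PD R n S -> diagonal_off V S -> diagonal_off V (invmx S).
Proof.
move=> PDS dS s t; have PDK := PD_inv PDS.
wlog sV : s t / s \notin V => [gen st|st _].
  rewrite negb_and => /orP[sV|tV]; first by apply: gen; rewrite // negb_and sV.
  by rewrite (PD_sym _ _ PDK); apply: gen; rewrite // 1?eq_sym // negb_and tV.
apply: (PD_isolated PDK) => [u us|]; last by rewrite eq_sym.
by rewrite invmxK dS ?mul0r // 1?eq_sym // negb_and sV.
Qed.

(** In an entry of [invmx S *m S] with indices in [V], the terms with middle index outside [V]
    vanish, so the product of the two blocks is the block of the product. *)
Lemma block_inv n m (V : m.-tuple 'I_n) (S : 'M[R]_n) :
  uniq V -> PD R n S -> diagonal_off V S ->
  invmx (block V S) = block V (invmx S).
Proof.
move=> uV PDS dS; have uB := PD_unit (PD_block uV PDS).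
rewrite -[RHS](mulmxK uB) -[LHS]mul1mx; congr (_ *m _).
apply/matrixP => a b; rewrite !mxE.
under eq_bigr do rewrite !mxE.
rewrite -(big_tuple _ _ V xpredT
  (fun u => invmx S (tnth V a) u * S u (tnth V b))) /= big_uniq //=.
have injV : injective (tnth V) by apply/tuple_uniqP.
rewrite -(inj_eq injV) -(mulmxV_entry _ _ PDS).
rewrite [LHS](bigID (mem V)) /= [X in _ + X]big1 ?addr0 //.
move=> u uV'; rewrite dS ?mulr0 //; last by rewrite negb_and uV'.
by apply: contraNneq uV' => ->; apply: mem_tnth.
Qed.

(* A vertex outside [V] is isolated in [G :&: H], so at each position of its row
   [S] or [invmx S] vanishes. *)
Lemma double_markov_padded n m (V : m.-tuple 'I_n) (G H : {set {set 'I_n}}) :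
  uniq V -> {subset finset.cover (G :&: H) <= V} ->
  double_markov R G H = padded V (double_markov R (induced V G) (induced V H)).
Proof.
move=> uV subV; have injV : injective (tnth V) by apply/tuple_uniqP.
apply/seteqP; split=> S.
  move=> /double_markovP[PDS zS zK].
  have dS : diagonal_off V S.
    move=> s t; wlog sV : s t / s \notin V => [gen st|st _].
      rewrite negb_and => /orP[sV|tV].
        by apply: gen; rewrite // negb_and sV.
      by rewrite (PD_sym _ _ PDS); apply: gen; rewrite // 1?eq_sym // negb_and tV.
    apply: (PD_isolated PDS); last by rewrite eq_sym.
    move=> u us; have [uG|uG] := boolP (edge s u \in G); last first.
      by rewrite zK ?mul0r // eq_sym.
    rewrite zS ?mulr0 // edgeC; apply: contra sV => uH; apply: subV.
    by apply/finset.bigcupP; exists (edge s u); rewrite !inE ?uG ?eqxx.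
  split=> //; apply/double_markovP; split; first exact: PD_block.
    by move=> i j ij; rewrite mem_induced // => ?; rewrite mxE zS // inj_eq.
  move=> i j ij; rewrite mem_induced // => ?.
  by rewrite block_inv // mxE zK // inj_eq.
move=> [PDS /double_markovP[_ zS zK] dS]; apply/double_markovP; split=> //.
  move=> s t st stH; have [/andP[/tnthP[i Ei] /tnthP[j Ej]]|] :=
    boolP ((s \in V) && (t \in V)); last exact: dS.
  have ij : i != j by rewrite -(inj_eq injV) -Ei -Ej.
  by have := zS i j ij; rewrite mxE mem_induced // -Ei -Ej; apply.
move=> s t st stG; have [/andP[/tnthP[i Ei] /tnthP[j Ej]]|] :=
  boolP ((s \in V) && (t \in V)); last exact: (diagonal_off_inv PDS dS).
have ij : i != j by rewrite -(inj_eq injV) -Ei -Ej.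
by have := zK i j ij; rewrite block_inv // mxE mem_induced // -Ei -Ej; apply.
Qed.

Lemma double_markov_clique n m (V : m.-tuple 'I_n) (G H : {set {set 'I_n}}) :
  uniq V -> {subset finset.cover (G :&: H) <= V} ->
  (forall s t, s \in V -> t \in V -> s != t -> edge s t \in G :&: H) ->
  double_markov R G H = padded V (PD R m).
Proof.
move=> uV subV clique; rewrite (double_markov_padded uV subV).
have injV : injective (tnth V) by apply/tuple_uniqP.
congr (padded V _); apply/seteqP; split=> [S /double_markovP[]//|S PDS].
apply/double_markovP; split=> // i j ij; rewrite mem_induced //.
  by have := clique _ _ (mem_tnth i V) (mem_tnth j V); rewrite inj_eq // inE => /(_ ij) /andP[_ ->].
by have := clique _ _ (mem_tnth i V) (mem_tnth j V); rewrite inj_eq // inE => /(_ ij) /andP[->].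
Qed.

End DoubleMarkov.

(** * Connected graphs with three edges *)

Lemma edge_at n (e : {set 'I_n}) x :
  #|e| = 2%N -> x \in e -> exists2 y, x != y & e = edge x y.
Proof.
move=> /eqP/cards2P[a [b [ab ->]]]; rewrite !inE => /orP[] /eqP->.
  by exists b.
by exists a; rewrite 1?eq_sym // edgeC.
Qed.

(* Otherwise the vertices of [e] would form a connected component. *)
Lemma connected_edge_meets n (F : {set {set 'I_n}}) e :
  simple_graph F -> connected_on_support F -> (1 < #|F|)%N -> e \in F ->
  exists2 e', e' \in F :\ e & exists2 x, x \in e & x \in e'.
Proof.
move=> simpleF connF F1 eF.
have [e0 e0F] : exists e0, e0 \in F :\ e.
  by apply/set0Pn; rewrite -card_gt0; move: F1; rewrite (cardsD1 e) eF.
suff /exists_inP[e' e'F /exists_inP meet] :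
  [exists e' in F :\ e, [exists x in e, x \in e']] by exists e'.
apply: contraT => /exists_inPn noMeet; exfalso.
have disj e' z : e' \in F -> e' != e -> z \in e -> z \notin e'.
  move=> e'F e'e ze; apply/negP => ze'.
  have /noMeet/negP[] : e' \in F :\ e by rewrite !inE e'e.
  by apply/exists_inP; exists z.
have [e0e e0F'] : e0 != e /\ e0 \in F by move: e0F; rewrite !inE => /andP[].
have [x xe] : exists x, x \in e by apply/set0Pn; rewrite -card_gt0 simpleF.
have [y ye0] : exists y, y \in e0 by apply/set0Pn; rewrite -card_gt0 simpleF.
have cl : closed [rel x y | edge x y \in F] (mem e).
  have step u v : edge u v \in F -> u \in e -> v \in e.
    move=> uvF ue; have [<-|uve] := eqVneq (edge u v) e; first exact: set22.
    by have := disj _ _ uvF uve ue; rewrite set21.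
  by move=> u v uvF; apply/idP/idP; apply: step => //; rewrite edgeC.
have xy : connect [rel x y | edge x y \in F] x y.
  by apply: connF; apply/finset.bigcupP; [exists e|exists e0].
have := closed_connect cl xy; rewrite xe => /esym ye.
by have := disj _ _ e0F' e0e ye; rewrite ye0.
Qed.

(** Connectivity gives two edges [ab], [ac] with a common vertex and a vertex [x] where the third
    edge [xd] meets one of them. If [x = a], this is a star. If [x] is [b] or [c], the third edge
    either joins [b] to [c] and closes the triangle or prolongs the path. *)
Lemma connected3_shape n (F : {set {set 'I_n}}) :
  simple_graph F -> connected_on_support F -> #|F| = 3%N ->
  [\/ exists i j k, uniq [:: i; j; k] /\ F = triangle i j k,
      exists i j k l, uniq [:: i; j; k; l] /\ F = path_graph i j k l
    | exists i j k l, uniq [:: i; j; k; l] /\ F = star_graph i j k l].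
Proof.
move=> simpleF connF F3; have F1 : (1 < #|F|)%N by rewrite F3.
have meets := connected_edge_meets simpleF connF F1.
have [e1 e1F] : exists e1, e1 \in F by apply/set0Pn; rewrite -card_gt0 F3.
have [e2 e2F' [a ae1 ae2]] := meets _ e1F.
have /eqP/cards1P[e3 E3] : #|F :\ e1 :\ e2| = 1%N.
  by move: F3; rewrite (cardsD1 e1) e1F (cardsD1 e2) e2F' => -[].
have FE : F = [set e1; e2; e3]%SET.
  by rewrite -(finset.setD1K e1F) -(finset.setD1K e2F') E3 finset.setUA.
have e3F' : e3 \in F :\ e1 :\ e2 by rewrite E3 set11.
move: e2F' e3F'; rewrite !inE => /andP[e21 e2F] /and3P[e32 e31 e3F].
have [b ab Ee1] := edge_at (simpleF _ e1F) ae1.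
have [c ac Ee2] := edge_at (simpleF _ e2F) ae2.
have [e' e'F [x xe3 xe']] := meets _ e3F.
have [d xd Ee3] := edge_at (simpleF _ e3F) xe3.
have xabc : x \in [:: a; b; c].
  move: e'F xe'; rewrite FE !inE Ee1 Ee2 => /andP[/negPf->]; rewrite orbF.
  by case/orP => /eqP->; rewrite !inE => /orP[] ->; rewrite ?orbT.
have bc : b != c by apply: contra_neq e21 => E; rewrite Ee1 Ee2 E.
rewrite FE {FE E3} Ee1 Ee2 Ee3 in e31 e32 *.
move: e31 e32; rewrite !edge_eq.
move: xabc; rewrite !inE => /or3P[] /eqP xE; subst x; rewrite !eqxx /=.
- rewrite (negPf ab) (negPf ac) !orbF => db dc; apply: Or33.
  exists a, b, c, d; rewrite /= !inE !negb_or ab ac xd bc.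
  by rewrite ![_ == d]eq_sym db dc.
- rewrite (eq_sym b a) (negPf ab) (negPf bc) /= => da _.
  have [E|dc] := eqVneq d c.
    by subst d; apply: Or31; exists a, b, c; rewrite /= !inE !negb_or ab ac bc.
  apply: Or32; exists c, a, b, d; split; last first.
    by rewrite /path_graph (edgeC c a) (finset.setUC [set edge a b]).
  rewrite /= !inE !negb_or ![c == _]eq_sym ac bc dc ab xd.
  by rewrite (eq_sym a d) da.
- rewrite (eq_sym c a) (eq_sym c b) (negPf ac) (negPf bc) /= => _ da.
  have [E|db] := eqVneq d b.
    by subst d; apply: Or31; exists a, b, c; rewrite /= !inE !negb_or ab ac bc (edgeC c b).
  apply: Or32; exists b, a, c, d; split; last first.
    by rewrite /path_graph (edgeC b a).
  rewrite /= !inE !negb_or ![b == _]eq_sym ab db ac xd (eq_sym c b) bc.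
  by rewrite (eq_sym a d) da.
Qed.

(** * Reduction to the list of cases *)

Definition edges4 : seq {set 'I_4} := [:: e12; e13; e14; e23; e24; e34].

Lemma ord4_case (P : 'I_4 -> Prop) : P v1 -> P v2 -> P v3 -> P v4 -> forall i, P i.
Proof.
move=> P1 P2 P3 P4; case=> -[|[|[|[|//]]]] i4.
- by rewrite (_ : Ordinal i4 = v1) //; apply: val_inj.
- by rewrite (_ : Ordinal i4 = v2) //; apply: val_inj.
- by rewrite (_ : Ordinal i4 = v3) //; apply: val_inj.
- by rewrite (_ : Ordinal i4 = v4) //; apply: val_inj.
Qed.

Lemma mem_edges4 e : (e \in edges4) = (#|e| == 2%N).
Proof.
apply/idP/idP => [|/cards2P[a [b [ab ->]]]].
  by rewrite !inE => /or4P[/eqP->|/eqP->|/eqP->|/or3P[]/eqP->]; rewrite card_edge.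
rewrite -/(edge a b) !inE !edge_eq; move: ab.
by elim/ord4_case: a; elim/ord4_case: b.
Qed.

Lemma edges4_uniq : uniq edges4.
Proof. by rewrite /= !inE !edge_eq. Qed.

(* The incidence vector of [F] on the four vertices [a, b, c, d], in the order
   of [edges4]. *)
Definition code n (a b c d : 'I_n) (F : {set {set 'I_n}}) : seq bool :=
  [:: edge a b \in F; edge a c \in F; edge a d \in F; edge b c \in F;
      edge b d \in F; edge c d \in F].

Notation code4 := (code v1 v2 v3 v4).

(** [code4] does not see sets of cardinality other than 2; simplicity excludes them from both
    graphs. *)
Lemma code4_inj (F F' : {set {set 'I_4}}) :
  simple_graph F -> simple_graph F' -> code4 F = code4 F' -> F = F'.
Proof.
move=> sF sF' /(eq_in_map (mem F) (mem F') edges4) eqF.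
apply/finset.setP => e; have [/eqF //|] := boolP (e \in edges4).
rewrite mem_edges4 => e2; rewrite [LHS](negbTE _) ?[RHS](negbTE _) //.
  by apply: contraNN e2 => /sF' ->.
by apply: contraNN e2 => /sF ->.
Qed.

Lemma card_nonedges4 (F : {set {set 'I_4}}) :
  #|nonedges F| = count negb (code4 F).
Proof.
rewrite -[code4 F]/(map (mem F) edges4) count_map -size_filter.
rewrite -(card_uniqP (filter_uniq _ edges4_uniq)); apply: eq_card => e.
by rewrite !inE mem_filter mem_edges4.
Qed.

Lemma code_induced n (a b c d : 'I_n) (F : {set {set 'I_n}}) :
  code4 (induced [tuple a; b; c; d] F) = code a b c d F.
Proof. by rewrite /code !mem_induced. Qed.

Lemma induced_simple n m (V : m.-tuple 'I_n) (F : {set {set 'I_n}}) :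
  simple_graph (induced V F).
Proof. by move=> e; rewrite inE => /andP[/eqP]. Qed.

Definition codes := map (fun p : {set {set 'I_4}} * {set {set 'I_4}} =>
  (code4 p.1, code4 p.2)).

(** This turns membership in a list of pairs of graphs into membership in a list of Boolean vectors,
    which is decided by computation. Inclusion in [K4] makes the listed graphs simple, as
    [code4_inj] requires. *)
Lemma mem_codes (G H : {set {set 'I_4}}) (L : seq ({set {set 'I_4}} * {set {set 'I_4}})) :
  simple_graph G -> simple_graph H ->
  (forall p : {set {set 'I_4}} * {set {set 'I_4}}, p \in L -> p.1 \subset K4 /\ p.2 \subset K4) ->
  (code4 G, code4 H) \in codes L -> (G, H) \in L.
Proof.
move=> sG sH LK /mapP[[G' H'] L' E].
have [GG' HH'] := (congr1 fst E, congr1 snd E); have [/= KG KH] := LK _ L'.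
have sK (F : {set {set 'I_4}}) : F \subset K4 -> simple_graph F.
  move=> /fintype.subsetP FK e /FK; rewrite !inE => eK; apply/eqP.
  by rewrite -mem_edges4 !inE; move: eK; rewrite -!orbA.
by rewrite (code4_inj sG (sK _ KG) GG') (code4_inj sH (sK _ KH) HH').
Qed.

(** Both graphs contain the intersection, so only the other three pairs carry information;
    [star_code] is built likewise. *)
Definition path_code (x : bool * bool * bool) :=
  let: (x13, x14, x24) := x in [:: true; x13; x14; true; x24; true].

Definition star_code (x : bool * bool * bool) :=
  let: (x23, x24, x34) := x in [:: true; true; true; x23; x24; x34].

Section IncidenceVectors.
Local Notation "1" := true.
Local Notation "0" := false.

Definition path_extras : seq (bool * bool * bool * (bool * bool * bool)) :=
  [:: ((1, 1, 1), (0, 0, 0)); ((0, 1, 1), (0, 0, 0)); ((1, 0, 1), (0, 0, 0));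
      ((0, 0, 1), (0, 0, 0)); ((0, 1, 0), (0, 0, 0)); ((0, 0, 0), (0, 0, 0));
      ((0, 1, 1), (1, 0, 0)); ((0, 0, 1), (1, 0, 0)); ((0, 1, 0), (1, 0, 0));
      ((1, 0, 1), (0, 1, 0)); ((0, 0, 1), (0, 1, 0))].

Definition star_extras : seq (bool * bool * bool * (bool * bool * bool)) :=
  [:: ((1, 1, 1), (0, 0, 0)); ((0, 1, 1), (0, 0, 0)); ((0, 1, 1), (1, 0, 0));
      ((0, 0, 1), (0, 0, 0)); ((0, 0, 1), (1, 0, 0)); ((0, 0, 0), (0, 0, 0))].

Lemma codeU n (a b c d : 'I_n) (A B : {set {set 'I_n}}) :
  code a b c d (A :|: B) =
  [seq p.1 || p.2 | p <- zip (code a b c d A) (code a b c d B)].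
Proof. by rewrite /code !finset.in_setU. Qed.

Lemma codeD n (a b c d : 'I_n) (A B : {set {set 'I_n}}) :
  code a b c d (A :\: B) =
  [seq ~~ p.2 && p.1 | p <- zip (code a b c d A) (code a b c d B)].
Proof. by rewrite /code !finset.in_setD. Qed.

Lemma code4_set1 :
  (code4 [set e12]%SET = [:: 1; 0; 0; 0; 0; 0]) *
  (code4 [set e13]%SET = [:: 0; 1; 0; 0; 0; 0]) *
  (code4 [set e14]%SET = [:: 0; 0; 1; 0; 0; 0]) *
  (code4 [set e23]%SET = [:: 0; 0; 0; 1; 0; 0]) *
  (code4 [set e24]%SET = [:: 0; 0; 0; 0; 1; 0]) *
  (code4 [set e34]%SET = [:: 0; 0; 0; 0; 0; 1]).
Proof. by do !split; rewrite /code !finset.in_set1 !edge_eq. Qed.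

End IncidenceVectors.

Lemma codes_path :
  codes path_cases = [seq (path_code p.1, path_code p.2) | p <- path_extras].
Proof. by rewrite /codes /= /K4 /P4 /path_graph !(codeU, codeD) !code4_set1. Qed.

Lemma codes_star :
  codes star_cases = [seq (star_code p.1, star_code p.2) | p <- star_extras].
Proof. by rewrite /codes /= /K4 /S4 /star_graph !(codeU, codeD) !code4_set1. Qed.

Ltac sub_K4 := by apply/fintype.subsetP => e; rewrite !inE;
  do ?case: (_ == _).

Lemma path_cases_sub p : p \in path_cases -> p.1 \subset K4 /\ p.2 \subset K4.
Proof.
by rewrite !inE; do 10?[case/orP]; move=> /eqP->; split; sub_K4.
Qed.

Lemma star_cases_sub p : p \in star_cases -> p.1 \subset K4 /\ p.2 \subset K4.
Proof.
by rewrite !inE; do 5?[case/orP]; move=> /eqP->; split; sub_K4.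
Qed.

Lemma cover_path n (i j k l : 'I_n) :
  {subset finset.cover (path_graph i j k l) <= [:: i; j; k; l]}.
Proof.
move=> x /finset.bigcupP[e]; rewrite !inE => /orP[/orP[]|] /eqP->.
all: by rewrite !inE => /orP[] ->; rewrite ?orbT.
Qed.

Lemma cover_star n (i j k l : 'I_n) :
  {subset finset.cover (star_graph i j k l) <= [:: i; j; k; l]}.
Proof.
move=> x /finset.bigcupP[e]; rewrite !inE => /orP[/orP[]|] /eqP->.
all: by rewrite !inE => /orP[] ->; rewrite ?orbT.
Qed.

Lemma cover_triangle n (i j k : 'I_n) :
  {subset finset.cover (triangle i j k) <= [:: i; j; k]}.
Proof.
move=> x /finset.bigcupP[e]; rewrite !inE => /orP[/orP[]|] /eqP->.
all: by rewrite !inE => /orP[] ->; rewrite ?orbT.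
Qed.

(** All that depends on the graphs is stated on incidence vectors, so a reduction amounts to
    choosing an order of the vertices and an order of the two graphs. *)
Lemma reduces_toI (R : realType) n (G H G' H' : {set {set 'I_n}})
    (a b c d : 'I_n) s L :
  (G', H') = (G, H) \/ (G', H') = (H, G) ->
  uniq [:: a; b; c; d] -> perm_eq [:: a; b; c; d] s ->
  {subset finset.cover (G :&: H) <= s} ->
  (forall p : {set {set 'I_4}} * {set {set 'I_4}}, p \in L -> p.1 \subset K4 /\ p.2 \subset K4) ->
  (count negb (code a b c d G') <= count negb (code a b c d H'))%N ->
  (code a b c d G', code a b c d H') \in codes L ->
  reduces_to R G H s L.
Proof.
move=> GH uV Vs subs LK le_code codeL.
exists [tuple a; b; c; d], G', H'; split=> //.
- by rewrite !card_nonedges4 !code_induced.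
- apply: double_markov_padded => // x xGH; rewrite (perm_mem Vs); apply: subs.
  by case: GH xGH => -[-> ->] //; rewrite finset.setIC.
- apply: mem_codes LK _; [exact: induced_simple|exact: induced_simple|].
  by rewrite !code_induced.
Qed.

Definition listed (code_of : bool * bool * bool -> seq bool)
    (extras : seq (bool * bool * bool * (bool * bool * bool))) x y :=
  (count negb (code_of x) <= count negb (code_of y))%N && ((x, y) \in extras).

Lemma nonedge_path n (i j k l : 'I_n) : uniq [:: i; j; k; l] ->
  [/\ edge i k \notin path_graph i j k l, edge i l \notin path_graph i j k l
    & edge j l \notin path_graph i j k l].
Proof.
rewrite /= !inE !negb_or !edge_eq => /and4P[/and3P[ij ik il] /andP[jk jl] kl _].
rewrite !eqxx /= ![k == _]eq_sym ![l == _]eq_sym ?(eq_sym j i).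
by rewrite (negPf ij) (negPf ik) (negPf il) (negPf jk) (negPf jl) (negPf kl).
Qed.

Lemma nonedge_star n (i j k l : 'I_n) : uniq [:: i; j; k; l] ->
  [/\ edge j k \notin star_graph i j k l, edge j l \notin star_graph i j k l
    & edge k l \notin star_graph i j k l].
Proof.
rewrite /= !inE !negb_or !edge_eq => /and4P[/and3P[ij ik il] /andP[jk jl] kl _].
rewrite !eqxx /= ![k == _]eq_sym ![l == _]eq_sym ?(eq_sym j i).
by rewrite (negPf ij) (negPf ik) (negPf il) (negPf jk) (negPf jl) (negPf kl).
Qed.

Lemma reduces_path (R : realType) n (G H : {set {set 'I_n}}) (i j k l : 'I_n) :
  uniq [:: i; j; k; l] -> G :&: H = path_graph i j k l ->
  reduces_to R G H [:: i; j; k; l] path_cases.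
Proof.
move=> uV GH.
have memGH e : (e \in G) && (e \in H) = (e \in path_graph i j k l).
  by rewrite -GH inE.
pose x (F : {set {set 'I_n}}) := (edge i k \in F, edge i l \in F, edge j l \in F).
(* The same triple read along the reversed path [l, k, j, i]: reversal exchanges the pairs 13 and 24
   and fixes 14. *)
pose y (F : {set {set 'I_n}}) := (edge j l \in F, edge i l \in F, edge i k \in F).
have [ijG ijH] : edge i j \in G /\ edge i j \in H.
  by apply/andP; rewrite memGH !inE eqxx.
have [jkG jkH] : edge j k \in G /\ edge j k \in H.
  by apply/andP; rewrite memGH !inE eqxx ?orbT.
have [klG klH] : edge k l \in G /\ edge k l \in H.
  by apply/andP; rewrite memGH !inE eqxx ?orbT.
have codex F : F = G \/ F = H -> code i j k l F = path_code (x F).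
  by case=> ->; rewrite /code ?(ijG, ijH, jkG, jkH, klG, klH).
have codey F : F = G \/ F = H -> code l k j i F = path_code (y F).
  rewrite /code (edgeC l k) (edgeC l j) (edgeC l i) (edgeC k j) (edgeC k i).
  by rewrite (edgeC j i); case=> ->; rewrite ?(ijG, ijH, jkG, jkH, klG, klH).
have [/negbTE ikN /negbTE ilN /negbTE jlN] := nonedge_path uV.
have cov : {subset finset.cover (G :&: H) <= [:: i; j; k; l]}.
  by rewrite GH; apply: cover_path.
have uW : uniq [:: l; k; j; i] by rewrite -rev_uniq.
have pW : perm_eq [:: l; k; j; i] [:: i; j; k; l] by rewrite -perm_rev.
(* Two orders of the path times two orders of the graphs. By [memGH] no pair outside the path lies
   in both graphs, and the claim is checked on all values of the six bits. *)
have : [|| listed path_code path_extras (x G) (x H),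
           listed path_code path_extras (x H) (x G),
           listed path_code path_extras (y G) (y H)
         | listed path_code path_extras (y H) (y G)].
  rewrite /x /y; move: (memGH (edge i k)) (memGH (edge i l)) (memGH (edge j l)).
  by rewrite ikN ilN jlN; do 6!case: (edge _ _ \in _).
have GG := or_introl (erefl G) : G = G \/ G = H.
have HH := or_intror (erefl H) : H = G \/ H = H.
have GHl := or_introl erefl : (G, H) = (G, H) \/ (G, H) = (H, G).
have HGr := or_intror erefl : (H, G) = (G, H) \/ (H, G) = (H, G).
case/or4P=> /andP[le_xy xy_in].
- apply: (reduces_toI _ GHl uV) path_cases_sub _ _ => //; rewrite !codex //.
  by rewrite codes_path (map_f _ xy_in).
- apply: (reduces_toI _ HGr uV) path_cases_sub _ _ => //; rewrite !codex //.
  by rewrite codes_path (map_f _ xy_in).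
- apply: (reduces_toI _ GHl uW) path_cases_sub _ _ => //; rewrite !codey //.
  by rewrite codes_path (map_f _ xy_in).
- apply: (reduces_toI _ HGr uW) path_cases_sub _ _ => //; rewrite !codey //.
  by rewrite codes_path (map_f _ xy_in).
Qed.

Lemma reduces_star (R : realType) n (G H : {set {set 'I_n}}) (i j k l : 'I_n) :
  uniq [:: i; j; k; l] -> G :&: H = star_graph i j k l ->
  reduces_to R G H [:: i; j; k; l] star_cases.
Proof.
move=> uV GH.
have memGH e : (e \in G) && (e \in H) = (e \in star_graph i j k l).
  by rewrite -GH inE.
pose x p q r (F : {set {set 'I_n}}) :=
  (edge p q \in F, edge p r \in F, edge q r \in F).
(* The centre [i] stays first; [p, q, r] runs through the orders of the leaves, with the swap of the
   graphs built in. *)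
pose ok p q r := listed star_code star_extras (x p q r G) (x p q r H)
  || listed star_code star_extras (x p q r H) (x p q r G).
have cov : {subset finset.cover (G :&: H) <= [:: i; j; k; l]}.
  by rewrite GH; apply: cover_star.
have reduce p q r : perm_eq [:: p; q; r] [:: j; k; l] -> ok p q r ->
    reduces_to R G H [:: i; j; k; l] star_cases.
  move=> pqr; have V : perm_eq [:: i; p; q; r] [:: i; j; k; l].
    by rewrite perm_cons.
  have uW : uniq [:: i; p; q; r] by rewrite (perm_uniq V).
  have inGH u : u \in [:: p; q; r] -> edge i u \in G /\ edge i u \in H.
    rewrite (perm_mem pqr) => ujkl; apply/andP; rewrite memGH !inE.
    by move: ujkl; rewrite !inE => /or3P[] /eqP->; rewrite eqxx ?orbT.
  have codex F : F = G \/ F = H -> code i p q r F = star_code (x p q r F).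
    have [pG pH] := inGH p (mem_head _ _).
    have [qG qH] : edge i q \in G /\ edge i q \in H.
      by apply: inGH; rewrite !inE eqxx orbT.
    have [rG rH] : edge i r \in G /\ edge i r \in H.
      by apply: inGH; rewrite !inE eqxx !orbT.
    by case=> ->; rewrite /code ?(pG, pH, qG, qH, rG, rH).
  case/orP=> /andP[le_xy xy_in].
    apply: (reduces_toI _ (or_introl erefl) uW) star_cases_sub _ _ => //;
      rewrite !codex; auto.
    by rewrite codes_star (map_f _ xy_in).
  apply: (reduces_toI _ (or_intror erefl) uW) star_cases_sub _ _ => //;
    rewrite !codex; auto.
  by rewrite codes_star (map_f _ xy_in).
have [/negbTE jkN /negbTE jlN /negbTE klN] := nonedge_star uV.
have : [|| ok j k l, ok j l k, ok k j l | [|| ok k l j, ok l j k | ok l k j]].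
  rewrite /ok /x !(edgeC k j) !(edgeC l j) !(edgeC l k).
  move: (memGH (edge j k)) (memGH (edge j l)) (memGH (edge k l)).
  by rewrite jkN jlN klN; do 6!case: (edge _ _ \in _).
by case/or4P=> [|||/or3P[]]; apply: reduce; apply/permP => a /=; lia.
Qed.

(** * Models on four vertices *)

Section FourByFour.
Variable R : realType.

Definition entries (A : 'M[R]_4) : seq R :=
  [:: A v1 v2; A v1 v3; A v1 v4; A v2 v3; A v2 v4; A v3 v4].

(* The partial covariance of [s] and [t] given [u] and [v], up to a positive
   factor. *)
Definition partial_cov (S : 'M[R]_4) s t u v : R :=
  S s t * (S u u * S v v - S u v ^+ 2)
  - S s u * (S t u * S v v - S u v * S t v)
  + S s v * (S t u * S u v - S u u * S t v).

Definition partial_covs (S : 'M[R]_4) : seq R :=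
  [:: partial_cov S v1 v2 v3 v4; partial_cov S v1 v3 v2 v4;
      partial_cov S v1 v4 v2 v3; partial_cov S v2 v3 v1 v4;
      partial_cov S v2 v4 v1 v3; partial_cov S v3 v4 v1 v2].

(** A true bit marks an edge and leaves the corresponding value free. *)
Definition zeros (c : seq bool) (x : seq R) : bool :=
  all (fun p => p.1 || (p.2 == 0)) (zip c x).

Lemma sum4 (s t u v : 'I_4) (f : 'I_4 -> R) : uniq [:: s; t; u; v] ->
  \sum_a f a = f s + f t + f u + f v.
Proof.
move=> uV; have V : perm_eq (index_enum 'I_4) [:: s; t; u; v].
  apply: uniq_perm => //; first exact: index_enum_uniq.
  move=> x; rewrite mem_index_enum; apply/esym.
  have /subset_cardP : #|[:: s; t; u; v]| = #|'I_4|.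
    by rewrite (card_uniqP uV) card_ord.
  by move=> /(_ (subset_predT _)) ->.
by rewrite (perm_big _ V) /= !big_cons big_nil addr0 !addrA.
Qed.

(** Cramer's rule without the 4 x 4 determinant: [cramer] relates [invmx S s t] to the minor with
    the coefficients [minor3 S t u v] and [invmx S s s], both positive. *)
Lemma invmx_eq0 (S : 'M[R]_4) s t u v : PD R 4 S -> uniq [:: s; t; u; v] ->
  (invmx S s t == 0) = (partial_cov S s t u v == 0).
Proof.
move=> PDS uV; have dM : 0 < minor3 S t u v.
  by apply: PD_minor3 => //; case/andP: uV.
have Kss := PD_diag_gt0 s (PD_inv PDS).
have eqn b : s != b -> invmx S s s * S s b + invmx S s t * S t b
    + invmx S s u * S u b + invmx S s v * S v b = 0.
  by move=> sb; have := mulmxV_entry s b PDS; rewrite (sum4 _ uV) (negPf sb).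
have cramer : invmx S s s * partial_cov S s t u v
    + invmx S s t * minor3 S t u v = 0.
  move: uV; rewrite /= !inE !negb_or => /and4P[/and3P[st su sv] _ _ _].
  have := eqn _ sv; have := eqn _ su; have := eqn _ st.
  rewrite (PD_sym v t PDS) (PD_sym u t PDS) (PD_sym v u PDS).
  move: (invmx S s s) (invmx S s t) (invmx S s u) (invmx S s v) => a b c d.
  move=> Et Eu Ev.
  (* The coefficients are the cofactors of the first row of the block on [t, u, v]. Combining the
     columns [t, u, v] of row [s] of [invmx S *m S = 1] with them eliminates the entries of
     [invmx S] at [(s, u)] and [(s, v)]. *)
  rewrite -[RHS](_ : (S u u * S v v - S u v ^+ 2) * 0
    - (S t u * S v v - S u v * S t v) * 0
    + (S t u * S u v - S u u * S t v) * 0 = 0); last by rewrite !mulr0; ring.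
  by rewrite -{1}Et -{1}Eu -{1}Ev /partial_cov /minor3; ring.
have [E|nz] := eqVneq (invmx S s t) 0; apply/esym/eqP.
  by move: cramer; rewrite E mul0r addr0 => /eqP; rewrite mulf_eq0 gt_eqF //= => /eqP.
move=> E; move: cramer; rewrite E mulr0 add0r => /eqP.
by rewrite mulf_eq0 (negPf nz) gt_eqF.
Qed.

Lemma zero_off4 (F : {set {set 'I_4}}) (A : 'M[R]_4) :
  A^T = A -> zero_off F A <-> zeros (code4 F) (entries A).
Proof.
move=> symA; have symE s t : A s t = A t s by rewrite -{1}symA mxE.
rewrite /zeros /=; split=> [zA|].
  by do !(apply/andP; split=> //); rewrite -implyNb; apply/implyP => ?;
    apply/eqP; apply: zA.
rewrite -!implyNb.
case/and5P=> /implyP Z1 /implyP Z2 /implyP Z3 /implyP Z4 /and3P[/implyP Z5 /implyP Z6 _].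
move=> s t; elim/ord4_case: s; elim/ord4_case: t => // _ nF.
all: apply/eqP; rewrite ?(nF, Z1, Z2, Z3, Z4, Z5, Z6) //.
all: by rewrite symE ?(Z1, Z2, Z3, Z4, Z5, Z6) // edgeC.
Qed.

Lemma zeros_invmx c (S : 'M[R]_4) : PD R 4 S ->
  zeros c (entries (invmx S)) = zeros c (partial_covs S).
Proof.
move=> PDS; have E s t u v := @invmx_eq0 S s t u v PDS.
by rewrite /zeros /entries; case: c => [|? [|? [|? [|? [|? [|? ?]]]]]] //=;
  rewrite (E v1 v2 v3 v4) ?(E v1 v3 v2 v4) ?(E v1 v4 v2 v3)
    ?(E v2 v3 v1 v4) ?(E v2 v4 v1 v3) ?(E v3 v4 v1 v2).
Qed.

Lemma double_markov4 (G H : {set {set 'I_4}}) (S : 'M[R]_4) :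
  double_markov R G H S <->
  [/\ PD R 4 S, zeros (code4 H) (entries S)
    & zeros (code4 G) (partial_covs S)].
Proof.
rewrite double_markovP; split=> -[PDS zS zK]; have [symS _] := PDS.
all: have [symK _] := PD_inv PDS; split=> //.
- exact/zero_off4.
- by rewrite -zeros_invmx //; apply/zero_off4.
- exact/zero_off4.
- by apply/zero_off4 => //; rewrite zeros_invmx.
Qed.

Lemma markov_inv4 (F : {set {set 'I_4}}) (S : 'M[R]_4) :
  markov_inv R F S <-> PD R 4 S /\ zeros (code4 F) (entries S).
Proof.
by rewrite markov_invP; split=> -[PDS zS]; split=> //; apply/zero_off4; case: PDS.
Qed.

Lemma mx4_eta (S : 'M[R]_4) :
  S = mx4 [:: [:: S v1 v1; S v1 v2; S v1 v3; S v1 v4];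
              [:: S v2 v1; S v2 v2; S v2 v3; S v2 v4];
              [:: S v3 v1; S v3 v2; S v3 v3; S v3 v4];
              [:: S v4 v1; S v4 v2; S v4 v3; S v4 v4]].
Proof.
apply/matrixP => i j; rewrite mxE.
by elim/ord4_case: i; elim/ord4_case: j.
Qed.

(** Positivity is phrased as [q <= 0] forcing [x = 0]: once [q] is a sum of nonnegative terms, each
    term is forced to vanish by linear arithmetic. *)
Lemma PD4I (S : 'M[R]_4) : S^T = S ->
  (forall x1 x2 x3 x4 : R,
     S v1 v1 * x1 ^+ 2 + S v2 v2 * x2 ^+ 2 + S v3 v3 * x3 ^+ 2 + S v4 v4 * x4 ^+ 2
     + 2 * (S v1 v2 * x1 * x2 + S v1 v3 * x1 * x3 + S v1 v4 * x1 * x4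
            + S v2 v3 * x2 * x3 + S v2 v4 * x2 * x4 + S v3 v4 * x3 * x4) <= 0 ->
     [/\ x1 = 0, x2 = 0, x3 = 0 & x4 = 0]) ->
  PD R 4 S.
Proof.
move=> symS pos; split=> // x x0; have symE s t : S s t = S t s.
  by rewrite -{1}symS mxE.
rewrite ltNge; apply: contra x0.
have uV : uniq [:: v1; v2; v3; v4] by [].
rewrite mxE (sum4 _ uV) !mxE !(sum4 _ uV).
rewrite (symE v2 v1) (symE v3 v1) (symE v4 v1) (symE v3 v2) (symE v4 v2) (symE v4 v3).
set q := (X in X <= 0) => q0.
have [|E1 E2 E3 E4] := pos (x 0 v1) (x 0 v2) (x 0 v3) (x 0 v4).
  by apply: le_trans q0; rewrite le_eqVlt; apply/orP; left; apply/eqP; rewrite /q; ring.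
by apply/eqP/rowP; elim/ord4_case; rewrite mxE.
Qed.

End FourByFour.

(** * Models described by which entries vanish *)

Section Cases.
Variable R : realType.

Lemma PD_symE (S : 'M[R]_4) : PD R 4 S ->
  (S v2 v1 = S v1 v2) * (S v3 v1 = S v1 v3) * (S v4 v1 = S v1 v4) *
  (S v3 v2 = S v2 v3) * (S v4 v2 = S v2 v4) * (S v4 v3 = S v3 v4).
Proof. by move=> PDS; do !split; apply: PD_sym. Qed.

Lemma code_K4 : code4 K4 = [:: true; true; true; true; true; true].
Proof. by rewrite /K4 !codeU !code4_set1. Qed.

Lemma code_P4 : code4 P4 = path_code (false, false, false).
Proof. by rewrite /P4 /path_graph !codeU !code4_set1. Qed.

Lemma code_S4 : code4 S4 = star_code (false, false, false).
Proof. by rewrite /S4 /star_graph !codeU !code4_set1. Qed.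

(** A common shape for models and for the sets describing them, in which unions become
    disjunctions. *)
Definition PD_such (b : 'M[R]_4 -> bool) : set 'M[R]_4 := [set S | PD R 4 S /\ b S].

Lemma PD_suchU b c : PD_such b `|` PD_such c = PD_such (fun S => b S || c S).
Proof.
apply/seteqP; split=> S; first by case=> -[PDS ?]; split=> //; apply/orP; [left|right].
by case=> PDS /orP[]; [left|right].
Qed.

Lemma eq_PD_such b c : b =1 c -> PD_such b = PD_such c.
Proof. by move=> bc; apply/seteqP; split=> S [PDS]; rewrite (bc, =^~ bc); split. Qed.

Definition codeE := (codeU, codeD, code4_set1, code_K4, code_P4, code_S4).

(** If [S] is supported on the path, each minor is, up to sign and a positive diagonal entry, the
    product of the entries along the subpath joining its two vertices. *)
Lemma double_markov_P4 G g13 g14 g24 (S : 'M[R]_4) :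
  code4 G = path_code (g13, g14, g24) ->
  double_markov R G P4 S <->
  PD R 4 S /\
  [&& S v1 v3 == 0, S v1 v4 == 0, S v2 v4 == 0, g13 || (S v1 v2 * S v2 v3 == 0),
      g14 || (S v1 v2 * S v2 v3 * S v3 v4 == 0) & g24 || (S v2 v3 * S v3 v4 == 0)].
Proof.
move=> codeG; rewrite double_markov4 codeG code_P4 /zeros /=.
suff E : PD R 4 S -> S v1 v3 = 0 -> S v1 v4 = 0 -> S v2 v4 = 0 ->
    [/\ (partial_cov S v1 v3 v2 v4 == 0) = (S v1 v2 * S v2 v3 == 0),
        (partial_cov S v1 v4 v2 v3 == 0) = (S v1 v2 * S v2 v3 * S v3 v4 == 0)
      & (partial_cov S v2 v4 v1 v3 == 0) = (S v2 v3 * S v3 v4 == 0)].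
  split=> [[PDS /and4P[/eqP z13 /eqP z14 /eqP z24 _]]|
           [PDS /and4P[/eqP z13 /eqP z14 /eqP z24]]];
    have [-> -> ->] := E PDS z13 z14 z24; rewrite z13 z14 z24 eqxx !andbT //.
move=> PDS z13 z14 z24; have diag := gt_eqF (PD_diag_gt0 _ PDS).
split.
(* The false condition [S v4 v4 == 0] is inserted as a disjunct, which multiplies the product by the
   diagonal factor of the minor. *)
- rewrite -[RHS]orbF -(diag v4) -mulf_eq0 -oppr_eq0; congr (_ == _).
  by rewrite /partial_cov !(PD_symE PDS) z13 z14 z24; ring.
- congr (_ == _); rewrite /partial_cov !(PD_symE PDS) z13 z14 z24; ring.
- rewrite -[RHS]orbF -(diag v1) -mulf_eq0 -oppr_eq0; congr (_ == _).
  by rewrite /partial_cov !(PD_symE PDS) z13 z14 z24; ring.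
Qed.

(** As for the path: two leaves are joined through the centre, so each minor is the product of their
    two edges, up to sign and the diagonal entry of the third leaf. *)
Lemma double_markov_S4 G g23 g24 g34 (S : 'M[R]_4) :
  code4 G = star_code (g23, g24, g34) ->
  double_markov R G S4 S <->
  PD R 4 S /\
  [&& S v2 v3 == 0, S v2 v4 == 0, S v3 v4 == 0, g23 || (S v1 v2 * S v1 v3 == 0),
      g24 || (S v1 v2 * S v1 v4 == 0) & g34 || (S v1 v3 * S v1 v4 == 0)].
Proof.
move=> codeG; rewrite double_markov4 codeG code_S4 /zeros /=.
suff E : PD R 4 S -> S v2 v3 = 0 -> S v2 v4 = 0 -> S v3 v4 = 0 ->
    [/\ (partial_cov S v2 v3 v1 v4 == 0) = (S v1 v2 * S v1 v3 == 0),
        (partial_cov S v2 v4 v1 v3 == 0) = (S v1 v2 * S v1 v4 == 0)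
      & (partial_cov S v3 v4 v1 v2 == 0) = (S v1 v3 * S v1 v4 == 0)].
  split=> [[PDS /and4P[/eqP z23 /eqP z24 /eqP z34 _]]|
           [PDS /and4P[/eqP z23 /eqP z24 /eqP z34]]];
    have [-> -> ->] := E PDS z23 z24 z34; rewrite z23 z24 z34 eqxx !andbT //.
move=> PDS z23 z24 z34; have diag := gt_eqF (PD_diag_gt0 _ PDS).
split.
- rewrite -[RHS]orbF -(diag v4) -mulf_eq0 -oppr_eq0; congr (_ == _).
  by rewrite /partial_cov !(PD_symE PDS) z23 z24 z34; ring.
- rewrite -[RHS]orbF -(diag v3) -mulf_eq0 -oppr_eq0; congr (_ == _).
  by rewrite /partial_cov !(PD_symE PDS) z23 z24 z34; ring.
- rewrite -[RHS]orbF -(diag v2) -mulf_eq0 -oppr_eq0; congr (_ == _).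
  by rewrite /partial_cov !(PD_symE PDS) z23 z24 z34; ring.
Qed.

Lemma pmul_sqr_le0 (k x : R) : 0 < k -> k * x ^+ 2 <= 0 -> x = 0.
Proof.
by move=> k0; rewrite pmulr_rle0 // => x0; apply/eqP; rewrite -sqrf_eq0 eq_le x0 sqr_ge0.
Qed.

Lemma sqr_lt1 (x : R) : (x ^+ 2 < 1) = (-1 < x < 1).
Proof. by rewrite -ltr_norml -(real_normK (num_real x)) expr_lt1. Qed.

(** Completing the square after multiplication by [a]. Both conclusions serve for block sums: if a
    sum of two such forms is at most 0, nonnegativity bounds each of them by 0. *)
Lemma quadratic_form2 (a b d x y : R) : 0 < a -> 0 < a * d - b ^+ 2 ->
  0 <= a * x ^+ 2 + d * y ^+ 2 + 2 * (b * x * y) /\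
  (a * x ^+ 2 + d * y ^+ 2 + 2 * (b * x * y) <= 0 -> x = 0 /\ y = 0).
Proof.
move=> a0 d0; set q := _ + _ + _.
have E : a * q = (a * x + b * y) ^+ 2 + (a * d - b ^+ 2) * y ^+ 2.
  by rewrite /q; ring.
have y2 : 0 <= (a * d - b ^+ 2) * y ^+ 2 by rewrite mulr_ge0 ?sqr_ge0 // ltW.
have l2 := sqr_ge0 (a * x + b * y).
split=> [|q0]; first by rewrite -(pmulr_rge0 _ a0) E addr_ge0.
have aq : a * q <= 0 by rewrite pmulr_rle0.
have y0 : y = 0 by apply: (pmul_sqr_le0 d0); lra.
split=> //; apply: (pmul_sqr_le0 a0); apply: le_trans q0.
by rewrite /q y0 expr0n /= !mulr0 !addr0.
Qed.

Lemma direct_sum_PD2 (S : 'M[R]_4) :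
  direct_sum [tuple v1; v2] [tuple v3; v4] (PD R 2) (PD R 2) S <->
  PD R 4 S /\ [&& S v1 v3 == 0, S v1 v4 == 0, S v2 v3 == 0 & S v2 v4 == 0].
Proof.
split=> [[PDA PDB z]|[PDS /and4P[/eqP z13 /eqP z14 /eqP z23 /eqP z24]]]; last first.
  split; [exact: PD_block|exact: PD_block|].
  move=> s t; elim/ord4_case: s; elim/ord4_case: t => //= _ _;
  by rewrite ?(PD_symE PDS) ?(z13, z14, z23, z24).
have [z13 z14 z23 z24] : [/\ S v1 v3 = 0, S v1 v4 = 0, S v2 v3 = 0 & S v2 v4 = 0].
  by split; apply: z.
split; last by rewrite z13 z14 z23 z24 eqxx.
have A1 : 0 < S v1 v1 by have := PD_diag_gt0 0 PDA; rewrite mxE.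
have B1 : 0 < S v3 v3 by have := PD_diag_gt0 0 PDB; rewrite mxE.
have A2 : 0 < S v1 v1 * S v2 v2 - S v1 v2 ^+ 2.
  by have := PD_minor2 (isT : (0 : 'I_2) != 1) PDA; rewrite !mxE.
have B2 : 0 < S v3 v3 * S v4 v4 - S v3 v4 ^+ 2.
  by have := PD_minor2 (isT : (0 : 'I_2) != 1) PDB; rewrite !mxE.
have symA : S v1 v2 = S v2 v1 by have := PD_sym 0 1 PDA; rewrite !mxE.
have symB : S v3 v4 = S v4 v3 by have := PD_sym 0 1 PDB; rewrite !mxE.
apply: PD4I => [|x1 x2 x3 x4].
  apply/matrixP => s t; rewrite mxE; elim/ord4_case: s; elim/ord4_case: t => //;
  by rewrite ?(symA, symB, z13, z14, z23, z24) // z.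
rewrite z13 z14 z23 z24 => q0.
have [qA A0] := quadratic_form2 x1 x2 A1 A2.
have [qB B0] := quadratic_form2 x3 x4 B1 B2.
have [-> ->] : x1 = 0 /\ x2 = 0 by apply: A0; lra.
by have [-> ->] : x3 = 0 /\ x4 = 0 by apply: B0; lra.
Qed.

Lemma direct_sum_PD1 (S : 'M[R]_4) :
  direct_sum [tuple v1; v2] [tuple v3; v4] (PD1 R 2) (PD1 R 2) S <->
  PD1 R 4 S /\ [&& S v1 v3 == 0, S v1 v4 == 0, S v2 v3 == 0 & S v2 v4 == 0].
Proof.
split=> [[[PDA dA] [PDB dB] z]|[[PDS d] z]]; last first.
  have [PDA PDB off] := (direct_sum_PD2 S).2 (conj PDS z).
  by split=> //; split=> // i; rewrite mxE.
have [PDS off] : PD R 4 S /\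
    [&& S v1 v3 == 0, S v1 v4 == 0, S v2 v3 == 0 & S v2 v4 == 0].
  exact/direct_sum_PD2.
split=> //; split=> //; apply: ord4_case.
- by have := dA 0; rewrite mxE.
- by have := dA 1; rewrite mxE.
- by have := dB 0; rewrite mxE.
- by have := dB 1; rewrite mxE.
Qed.

Lemma padded_PD23 (S : 'M[R]_4) :
  padded [tuple v2; v3] (PD R 2) S <->
  PD R 4 S /\ [&& S v1 v2 == 0, S v1 v3 == 0, S v1 v4 == 0, S v2 v4 == 0 & S v3 v4 == 0].
Proof.
split=> [[PDS _ z]|[PDS /and5P[/eqP z12 /eqP z13 /eqP z14 /eqP z24 /eqP z34]]].
  by split=> //; rewrite !z ?eqxx.
split=> //; first exact: PD_block.
move=> s t; elim/ord4_case: s; elim/ord4_case: t => //= _ _;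
by rewrite ?(PD_symE PDS) ?(z12, z13, z14, z24, z34).
Qed.

(** The complete graph imposes nothing on the inverse, and [code4] only looks at pairs in [K4]. *)
Lemma double_markov_K4 F : double_markov R K4 F = markov_inv R (K4 :&: F).
Proof.
have codeI : code4 (K4 :&: F) = code4 F.
  rewrite -[LHS]/(map (mem (K4 :&: F)) edges4); apply/eq_in_map => e eK.
  by rewrite /= finset.in_setI; move: eK; rewrite !inE -!orbA => ->.
apply/seteqP; split=> S.
  by move=> /double_markov4[PDS zS _]; apply/markov_inv4; rewrite codeI.
move=> /markov_inv4[PDS zS]; apply/double_markov4.
by rewrite -codeI; split=> //; rewrite code_K4.
Qed.

Lemma PD_suchE (X : set 'M[R]_4) (b : 'M[R]_4 -> bool) :
  (forall S, X S <-> PD R 4 S /\ b S) -> X = PD_such b.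
Proof. by move=> Xb; apply/seteqP; split=> S /Xb. Qed.

Definition such_P4 G g13 g14 g24 codeG :=
  PD_suchE (fun S => @double_markov_P4 G g13 g14 g24 S codeG).
Definition such_PD12_PD34 := PD_suchE direct_sum_PD2.
Definition such_PD23 := PD_suchE padded_PD23.
Definition such_markov_inv F := PD_suchE (@markov_inv4 R F).

(** Both sides become Boolean expressions in the six conditions [S s t == 0], compared on all 64
    assignments. *)
Ltac by_zeros := rewrite ?(such_PD12_PD34, such_PD23, such_markov_inv) ?PD_suchU;
  apply: eq_PD_such => S; rewrite /zeros ?codeE /= ?mulf_eq0;
  case: (S v1 v2 == 0); case: (S v1 v3 == 0); case: (S v1 v4 == 0);
  case: (S v2 v3 == 0); case: (S v2 v4 == 0); case: (S v3 v4 == 0).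

Notation PD12_PD34 := (direct_sum [tuple v1; v2] [tuple v3; v4] (PD R 2) (PD R 2)).

Lemma path_case2 : double_markov R (K4 :\ e13)%SET P4 =
  PD12_PD34 `|` markov_inv R [set e23; e34]%SET.
Proof. by rewrite (@such_P4 _ false true true) ?codeE //; by_zeros. Qed.

(** The only condition is [S12 S23 S34 = 0]; each vanishing factor gives one of the three pieces. *)
Lemma path_case3 : double_markov R (K4 :\ e14)%SET P4 =
  PD12_PD34 `|` markov_inv R [set e12; e23]%SET `|` markov_inv R [set e23; e34]%SET.
Proof. by rewrite (@such_P4 _ true false true) ?codeE //; by_zeros. Qed.

(** The condition [S12 S23 = 0] from 13 implies [S12 S23 S34 = 0] from 14, so the model equals that
    of [path_case2]. *)
Lemma path_case4 : double_markov R (K4 :\: [set e13; e14])%SET P4 =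
  PD12_PD34 `|` markov_inv R [set e23; e34]%SET.
Proof. by rewrite (@such_P4 _ false false true) ?codeE //; by_zeros. Qed.

Lemma path_case5 : double_markov R (K4 :\: [set e13; e24])%SET P4 =
  PD12_PD34 `|` padded [tuple v2; v3] (PD R 2).
Proof. by rewrite (@such_P4 _ false true false) ?codeE //; by_zeros. Qed.

Lemma path_case6 : double_markov R P4 P4 =
  PD12_PD34 `|` padded [tuple v2; v3] (PD R 2).
Proof. by rewrite (@such_P4 _ false false false) ?codeE //; by_zeros. Qed.

End Cases.

(** * Correlation matrices *)

Section UnitCases.
Variable R : realType.

Definition PD1_such (b : 'M[R]_4 -> bool) : set 'M[R]_4 := [set S | PD1 R 4 S /\ b S].

Lemma PD1_suchU b c : PD1_such b `|` PD1_such c = PD1_such (fun S => b S || c S).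
Proof.
apply/seteqP; split=> S; first by case=> -[PDS ?]; split=> //; apply/orP; [left|right].
by case=> PDS /orP[]; [left|right].
Qed.

Lemma PD1_suchI b c : PD1_such b `&` PD1_such c = PD1_such (fun S => b S && c S).
Proof.
apply/seteqP; split=> S; first by case=> -[PDS ?] [_ ?]; split=> //; apply/andP.
by case=> PDS /andP[].
Qed.

(** Comparing on correlation matrices only makes inequalities such as [S12 ^+ 2 < 1] available for
    cancelling factors. *)
Lemma eq_PD1_such b c : (forall S, PD1 R 4 S -> b S = c S) -> PD1_such b = PD1_such c.
Proof. by move=> bc; apply/seteqP; split=> S [PDS bS]; split; rewrite ?bc // -bc. Qed.

Lemma double_markov1E (G H : {set {set 'I_4}}) :
  double_markov1 R G H = PD1_such (fun S =>
    zeros (code4 H) (entries S) && zeros (code4 G) (partial_covs S)).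
Proof.
apply/seteqP; split=> S; first by case=> /double_markov4[? ? ?] ?; split=> //; apply/andP.
by case=> -[PDS d] /andP[? ?]; split=> //; apply/double_markov4.
Qed.

Lemma such_PD1_12_34 :
  direct_sum [tuple v1; v2] [tuple v3; v4] (PD1 R 2) (PD1 R 2) =
  PD1_such (fun S => [&& S v1 v3 == 0, S v1 v4 == 0, S v2 v3 == 0 & S v2 v4 == 0]).
Proof. by apply/seteqP; split=> S /direct_sum_PD1. Qed.

Lemma PD1_sqr_lt1 n (S : 'M[R]_n) s t : PD1 R n S -> s != t -> S s t ^+ 2 < 1.
Proof.
by move=> [PDS d] st; have := PD_minor2 st PDS; rewrite !d mulr1 subr_gt0.
Qed.

(** With unit diagonal and [S t u = 0], [minor3 S s t u] is [1 - S s t ^+ 2 - S s u ^+ 2]. *)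
Lemma PD1_sqr2_lt1 n (S : 'M[R]_n) s t u : PD1 R n S -> uniq [:: s; t; u] ->
  S t u = 0 -> S s t ^+ 2 + S s u ^+ 2 < 1.
Proof.
move=> [PDS d] uV z; have := PD_minor3 uV PDS.
by rewrite /minor3 !d z; lra.
Qed.

Ltac sym_mx4 := by apply/matrixP; elim/ord4_case; elim/ord4_case; rewrite !mxE.

Lemma PD_tree_path (a b c : R) : a ^+ 2 < 1 -> b ^+ 2 + c ^+ 2 < 1 ->
  PD R 4 (mx4 [:: [:: 1; a; a * b; 0]; [:: a; 1; b; 0];
                  [:: a * b; b; 1; c]; [:: 0; 0; c; 1]]).
Proof.
move=> a1 bc1; apply: PD4I => [|x1 x2 x3 x4]; first by sym_mx4.
rewrite !mxE /= => q0.
have k1 : 0 < 1 - a ^+ 2 by rewrite subr_gt0.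
have k2 : 0 < 1 - b ^+ 2 - c ^+ 2 by lra.
(* Because the entry at 13 is [a * b], replacing [x2] by [x2 + a * x1] decouples [x1]. The quadratic
   form is exactly the sum of the five terms [s1] to [s5]. *)
have s1 := mulr_ge0 (ltW k1) (sqr_ge0 x1).
have s2 := mulr_ge0 (ltW k2) (sqr_ge0 (x2 + a * x1)).
have s3 := mulr_ge0 (ltW k2) (sqr_ge0 x4).
have s4 := sqr_ge0 (x3 + b * (x2 + a * x1) + c * x4).
have s5 := sqr_ge0 (c * (x2 + a * x1) - b * x4).
have E1 : x1 = 0 by apply: (pmul_sqr_le0 k1); lra.
have E4 : x4 = 0 by apply: (pmul_sqr_le0 k2); lra.
have E2 : x2 + a * x1 = 0 by apply: (pmul_sqr_le0 k2); lra.
have E3 : x3 + b * (x2 + a * x1) + c * x4 = 0.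
  by apply: (pmul_sqr_le0 ltr01); lra.
split=> //; first by move: E2; rewrite E1 mulr0 addr0.
by move: E3; rewrite E2 E4 !mulr0 !addr0.
Qed.

Lemma PD_star (a b c : R) : a ^+ 2 + b ^+ 2 + c ^+ 2 < 1 ->
  PD R 4 (mx4 [:: [:: 1; a; b; c]; [:: a; 1; 0; 0];
                  [:: b; 0; 1; 0]; [:: c; 0; 0; 1]]).
Proof.
move=> abc; apply: PD4I => [|x1 x2 x3 x4]; first by sym_mx4.
rewrite !mxE /= => q0.
have k : 0 < 1 - (a ^+ 2 + b ^+ 2 + c ^+ 2) by rewrite subr_gt0.
have s1 := sqr_ge0 (x1 + a * x2 + b * x3 + c * x4).
have s2 := mulr_ge0 (ltW k) (sqr_ge0 x2).
have s3 := mulr_ge0 (ltW k) (sqr_ge0 x3).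
have s4 := mulr_ge0 (ltW k) (sqr_ge0 x4).
(* [s5] to [s7] are the remainder in Lagrange's identity for [a * x2 + b * x3 + c * x4], left after
   completing the square in [x1]. *)
have s5 := sqr_ge0 (a * x3 - b * x2).
have s6 := sqr_ge0 (a * x4 - c * x2).
have s7 := sqr_ge0 (b * x4 - c * x3).
have E2 : x2 = 0 by apply: (pmul_sqr_le0 k); lra.
have E3 : x3 = 0 by apply: (pmul_sqr_le0 k); lra.
have E4 : x4 = 0 by apply: (pmul_sqr_le0 k); lra.
have : x1 + a * x2 + b * x3 + c * x4 = 0 by apply: (pmul_sqr_le0 ltr01); lra.
by rewrite E2 E3 E4 !mulr0 !addr0 => ->.
Qed.

Lemma PD_triangle (a b : R) : a ^+ 2 < 1 -> b ^+ 2 < 1 ->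
  PD R 4 (mx4 [:: [:: 1; a; b; 0]; [:: a; 1; a * b; 0];
                  [:: b; a * b; 1; 0]; [:: 0; 0; 0; 1]]).
Proof.
move=> a1 b1; apply: PD4I => [|x1 x2 x3 x4]; first by sym_mx4.
rewrite !mxE /= => q0.
have k1 : 0 < 1 - a ^+ 2 by rewrite subr_gt0.
have k2 : 0 < 1 - b ^+ 2 by rewrite subr_gt0.
(* Completing this square cancels the cross term [2 * (a * b) * x2 * x3] exactly. *)
have s1 := sqr_ge0 (x1 + a * x2 + b * x3).
have s2 := mulr_ge0 (ltW k1) (sqr_ge0 x2).
have s3 := mulr_ge0 (ltW k2) (sqr_ge0 x3).
have s4 := sqr_ge0 x4.
have E2 : x2 = 0 by apply: (pmul_sqr_le0 k1); lra.
have E3 : x3 = 0 by apply: (pmul_sqr_le0 k2); lra.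
have E4 : x4 = 0 by apply: (pmul_sqr_le0 ltr01); lra.
have : x1 + a * x2 + b * x3 = 0 by apply: (pmul_sqr_le0 ltr01); lra.
by rewrite E2 E3 !mulr0 !addr0 => ->.
Qed.

Lemma PD_cycle (a b c : R) : a ^+ 2 + b ^+ 2 < 1 -> b ^+ 2 + c ^+ 2 < 1 ->
  let e := - (a * b * c) / (1 - b ^+ 2) in
  PD R 4 (mx4 [:: [:: 1; a; 0; e]; [:: a; 1; b; 0];
                  [:: 0; b; 1; c]; [:: e; 0; c; 1]]).
Proof.
move=> ab bc /=; have k : 0 < 1 - b ^+ 2 by have := sqr_ge0 a; lra.
apply: PD4I => [|x1 x2 x3 x4]; first by sym_mx4.
rewrite !mxE /=; set q := (X in X <= 0) => q0.
(* The vector [(r, - b * r)] solves the linear system with matrix [[1 b; b 1]] and right-hand side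
   [(a, 0)], so the shift removes the cross terms of [x1] with [y2] and [y3]. The one with [x4]
   cancels because the corner entry is [- b * c * r]. What remains is the form of the path 2, 3,
   4. *)
pose r := a / (1 - b ^+ 2); pose y2 := x2 + r * x1; pose y3 := x3 - b * r * x1.
have k1 : 0 < 1 - a * r.
  by rewrite /r subr_gt0 mulrA -expr2 ltr_pdivrMr // mul1r; lra.
have k2 : 0 < 1 - b ^+ 2 - c ^+ 2 by lra.
have E : q = (1 - a * r) * x1 ^+ 2 + (1 - b ^+ 2 - c ^+ 2) * y2 ^+ 2
    + (1 - b ^+ 2 - c ^+ 2) * x4 ^+ 2 + (y3 + b * y2 + c * x4) ^+ 2
    + (c * y2 - b * x4) ^+ 2.
  by rewrite /q /y2 /y3 /r; field; rewrite gt_eqF.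
have s1 := mulr_ge0 (ltW k1) (sqr_ge0 x1).
have s2 := mulr_ge0 (ltW k2) (sqr_ge0 y2).
have s3 := mulr_ge0 (ltW k2) (sqr_ge0 x4).
have s4 := sqr_ge0 (y3 + b * y2 + c * x4).
have s5 := sqr_ge0 (c * y2 - b * x4).
rewrite {}E in q0.
have E1 : x1 = 0 by apply: (pmul_sqr_le0 k1); lra.
have E4 : x4 = 0 by apply: (pmul_sqr_le0 k2); lra.
have E2 : y2 = 0 by apply: (pmul_sqr_le0 k2); lra.
have E3 : y3 + b * y2 + c * x4 = 0 by apply: (pmul_sqr_le0 ltr01); lra.
split=> //; first by move: E2; rewrite /y2 E1 mulr0 addr0.
by move: E3; rewrite E2 E4 /y3 E1 !mulr0 !addr0 subr0.
Qed.

Lemma PD1_mx4 (S : 'M[R]_4) : PD R 4 S ->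
  [/\ S v1 v1 = 1, S v2 v2 = 1, S v3 v3 = 1 & S v4 v4 = 1] -> PD1 R 4 S.
Proof. by move=> PDS [d1 d2 d3 d4]; split=> //; apply: ord4_case. Qed.

(** The parameters are the entries themselves; their bounds come from 2 x 2 and 3 x 3 principal
    minors, and [PD_tree_path] shows that these bounds suffice. The descriptions below, except
    [such_star3], follow the same pattern. *)
Lemma tree_pathE : [set S | exists s12 s23 s34 : R,
    [/\ -1 < s12 < 1, s23 ^+ 2 + s34 ^+ 2 < 1 &
      S = mx4 [:: [:: 1; s12; s12 * s23; 0]; [:: s12; 1; s23; 0];
                  [:: s12 * s23; s23; 1; s34]; [:: 0; 0; s34; 1]]]] =
  PD1_such (fun S =>
    [&& S v1 v4 == 0, S v2 v4 == 0 & S v1 v3 == S v1 v2 * S v2 v3]).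
Proof.
apply/seteqP; split=> [_ [a [b [c [a1 bc ->]]]]|S [PD1S /and3P[/eqP z14 /eqP z24 /eqP z13]]].
  split; last by rewrite !mxE /= !eqxx.
  by apply: PD1_mx4; [apply: PD_tree_path; rewrite ?sqr_lt1|split; rewrite mxE].
have [PDS d] := PD1S; exists (S v1 v2), (S v2 v3), (S v3 v4); split.
- by rewrite -sqr_lt1 PD1_sqr_lt1.
(* Writing [S v3 v2] for [S v2 v3] centres the 3 x 3 minor at [v3], whose neighbours satisfy
   [S v2 v4 = 0]. *)
- by rewrite -(PD_symE PDS) (PD1_sqr2_lt1 PD1S).
- by rewrite [LHS]mx4_eta !(PD_symE PDS) !d z14 z24 z13.
Qed.

Lemma triangle12_23E : [set S | exists s12 s23 : R,
    [/\ -1 < s12 < 1, -1 < s23 < 1 &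
      S = mx4 [:: [:: 1; s12; s12 * s23; 0]; [:: s12; 1; s23; 0];
                  [:: s12 * s23; s23; 1; 0]; [:: 0; 0; 0; 1]]]] =
  PD1_such (fun S => [&& S v1 v4 == 0, S v2 v4 == 0, S v3 v4 == 0
    & S v1 v3 == S v1 v2 * S v2 v3]).
Proof.
apply/seteqP; split=> [_ [a [b [a1 b1 ->]]]|S [PD1S /and4P[/eqP z14 /eqP z24 /eqP z34 /eqP z13]]].
  split; last by rewrite !mxE /= !eqxx.
  apply: PD1_mx4; last by split; rewrite mxE.
  by apply: PD_tree_path; rewrite ?expr0n ?addr0 ?sqr_lt1.
have [PDS d] := PD1S; exists (S v1 v2), (S v2 v3); split.
- by rewrite -sqr_lt1 PD1_sqr_lt1.
- by rewrite -sqr_lt1 PD1_sqr_lt1.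
- by rewrite [LHS]mx4_eta !(PD_symE PDS) !d z14 z24 z34 z13.
Qed.

Lemma triangle12_13E : [set S | exists s12 s13 : R,
    [/\ -1 < s12 < 1, -1 < s13 < 1 &
      S = mx4 [:: [:: 1; s12; s13; 0]; [:: s12; 1; s12 * s13; 0];
                  [:: s13; s12 * s13; 1; 0]; [:: 0; 0; 0; 1]]]] =
  PD1_such (fun S => [&& S v1 v4 == 0, S v2 v4 == 0, S v3 v4 == 0
    & S v2 v3 == S v1 v2 * S v1 v3]).
Proof.
apply/seteqP; split=> [_ [a [b [a1 b1 ->]]]|S [PD1S /and4P[/eqP z14 /eqP z24 /eqP z34 /eqP z23]]].
  split; last by rewrite !mxE /= !eqxx.
  by apply: PD1_mx4; [apply: PD_triangle; rewrite ?sqr_lt1|split; rewrite mxE].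
have [PDS d] := PD1S; exists (S v1 v2), (S v1 v3); split.
- by rewrite -sqr_lt1 PD1_sqr_lt1.
- by rewrite -sqr_lt1 PD1_sqr_lt1.
- by rewrite [LHS]mx4_eta !(PD_symE PDS) !d z14 z24 z34 z23.
Qed.

Lemma cycleE : [set S | exists s12 s23 s34 : R,
    let s14 := - (s12 * s23 * s34) / (1 - s23 ^+ 2) in
    [/\ s12 ^+ 2 + s23 ^+ 2 < 1, s23 ^+ 2 + s34 ^+ 2 < 1 &
      S = mx4 [:: [:: 1; s12; 0; s14]; [:: s12; 1; s23; 0];
                  [:: 0; s23; 1; s34]; [:: s14; 0; s34; 1]]]] =
  PD1_such (fun S => [&& S v1 v3 == 0, S v2 v4 == 0
    & S v1 v4 == - (S v1 v2 * S v2 v3 * S v3 v4) / (1 - S v2 v3 ^+ 2)]).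
Proof.
apply/seteqP; split=> [_ [a [b [c [ab bc ->]]]]|S [PD1S /and3P[/eqP z13 /eqP z24 /eqP z14]]].
  split; last by rewrite !mxE /= !eqxx.
  by apply: PD1_mx4; [apply: PD_cycle|split; rewrite mxE].
have [PDS d] := PD1S; exists (S v1 v2), (S v2 v3), (S v3 v4); split.
- by rewrite -[S v1 v2](PD_symE PDS) (PD1_sqr2_lt1 PD1S).
- by rewrite -[S v2 v3](PD_symE PDS) (PD1_sqr2_lt1 PD1S).
- by rewrite [LHS]mx4_eta !(PD_symE PDS) !d z13 z24 z14.
Qed.

Lemma disc23_34E : [set S | exists s23 s34 : R, s23 ^+ 2 + s34 ^+ 2 < 1 /\
    S = mx4 [:: [:: 1; 0; 0; 0]; [:: 0; 1; s23; 0];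
                [:: 0; s23; 1; s34]; [:: 0; 0; s34; 1]]] =
  PD1_such (fun S =>
    [&& S v1 v2 == 0, S v1 v3 == 0, S v1 v4 == 0 & S v2 v4 == 0]).
Proof.
apply/seteqP; split=> [_ [b [c [bc ->]]]|S [PD1S /and4P[/eqP z12 /eqP z13 /eqP z14 /eqP z24]]].
  split; last by rewrite !mxE /= !eqxx.
  apply: PD1_mx4; last by split; rewrite mxE.
  have a1 : (0 : R) ^+ 2 < 1 by rewrite expr0n ltr01.
  by have := PD_tree_path a1 bc; rewrite mul0r.
have [PDS d] := PD1S; exists (S v2 v3), (S v3 v4); split.
  by rewrite -[S v2 v3](PD_symE PDS) (PD1_sqr2_lt1 PD1S).
by rewrite [LHS]mx4_eta !(PD_symE PDS) !d z12 z13 z14 z24.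
Qed.

Lemma disc13_14E : [set S | exists s13 s14 : R, s13 ^+ 2 + s14 ^+ 2 < 1 /\
    S = mx4 [:: [:: 1; 0; s13; s14]; [:: 0; 1; 0; 0];
                [:: s13; 0; 1; 0]; [:: s14; 0; 0; 1]]] =
  PD1_such (fun S =>
    [&& S v1 v2 == 0, S v2 v3 == 0, S v2 v4 == 0 & S v3 v4 == 0]).
Proof.
apply/seteqP; split=> [_ [b [c [bc ->]]]|S [PD1S /and4P[/eqP z12 /eqP z23 /eqP z24 /eqP z34]]].
  split; last by rewrite !mxE /= !eqxx.
  apply: PD1_mx4; last by split; rewrite mxE.
  by apply: PD_star; rewrite expr0n add0r.
have [PDS d] := PD1S; exists (S v1 v3), (S v1 v4); split.
  by rewrite (PD1_sqr2_lt1 PD1S).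
by rewrite [LHS]mx4_eta !(PD_symE PDS) !d z12 z23 z24 z34.
Qed.

Lemma disc12_14E : [set S | exists s12 s14 : R, s12 ^+ 2 + s14 ^+ 2 < 1 /\
    S = mx4 [:: [:: 1; s12; 0; s14]; [:: s12; 1; 0; 0];
                [:: 0; 0; 1; 0]; [:: s14; 0; 0; 1]]] =
  PD1_such (fun S =>
    [&& S v1 v3 == 0, S v2 v3 == 0, S v2 v4 == 0 & S v3 v4 == 0]).
Proof.
apply/seteqP; split=> [_ [b [c [bc ->]]]|S [PD1S /and4P[/eqP z13 /eqP z23 /eqP z24 /eqP z34]]].
  split; last by rewrite !mxE /= !eqxx.
  apply: PD1_mx4; last by split; rewrite mxE.
  by apply: PD_star; rewrite expr0n addr0.
have [PDS d] := PD1S; exists (S v1 v2), (S v1 v4); split.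
  by rewrite (PD1_sqr2_lt1 PD1S).
by rewrite [LHS]mx4_eta !(PD_symE PDS) !d z13 z23 z24 z34.
Qed.

Lemma segment12E : [set S | exists s12 : R, -1 < s12 < 1 /\
    S = mx4 [:: [:: 1; s12; 0; 0]; [:: s12; 1; 0; 0];
                [:: 0; 0; 1; 0]; [:: 0; 0; 0; 1]]] =
  PD1_such (fun S => [&& S v1 v3 == 0, S v1 v4 == 0, S v2 v3 == 0, S v2 v4 == 0
    & S v3 v4 == 0]).
Proof.
apply/seteqP; split=> [_ [a [a1 ->]]|S [PD1S]].
  split; last by rewrite !mxE /= !eqxx.
  apply: PD1_mx4; last by split; rewrite mxE.
  by apply: PD_star; rewrite expr0n !addr0 sqr_lt1.
case/and5P=> /eqP z13 /eqP z14 /eqP z23 /eqP z24 /eqP z34.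
have [PDS d] := PD1S; exists (S v1 v2); split; first by rewrite -sqr_lt1 PD1_sqr_lt1.
by rewrite [LHS]mx4_eta !(PD_symE PDS) !d z13 z14 z23 z24 z34.
Qed.

Lemma segment13E : [set S | exists s13 : R, -1 < s13 < 1 /\
    S = mx4 [:: [:: 1; 0; s13; 0]; [:: 0; 1; 0; 0];
                [:: s13; 0; 1; 0]; [:: 0; 0; 0; 1]]] =
  PD1_such (fun S => [&& S v1 v2 == 0, S v1 v4 == 0, S v2 v3 == 0, S v2 v4 == 0
    & S v3 v4 == 0]).
Proof.
apply/seteqP; split=> [_ [a [a1 ->]]|S [PD1S]].
  split; last by rewrite !mxE /= !eqxx.
  apply: PD1_mx4; last by split; rewrite mxE.
  by apply: PD_star; rewrite expr0n add0r addr0 sqr_lt1.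
case/and5P=> /eqP z12 /eqP z14 /eqP z23 /eqP z24 /eqP z34.
have [PDS d] := PD1S; exists (S v1 v3); split; first by rewrite -sqr_lt1 PD1_sqr_lt1.
by rewrite [LHS]mx4_eta !(PD_symE PDS) !d z12 z14 z23 z24 z34.
Qed.

Lemma segment14E : [set S | exists s14 : R, -1 < s14 < 1 /\
    S = mx4 [:: [:: 1; 0; 0; s14]; [:: 0; 1; 0; 0];
                [:: 0; 0; 1; 0]; [:: s14; 0; 0; 1]]] =
  PD1_such (fun S => [&& S v1 v2 == 0, S v1 v3 == 0, S v2 v3 == 0, S v2 v4 == 0
    & S v3 v4 == 0]).
Proof.
apply/seteqP; split=> [_ [a [a1 ->]]|S [PD1S]].
  split; last by rewrite !mxE /= !eqxx.
  apply: PD1_mx4; last by split; rewrite mxE.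
  by apply: PD_star; rewrite expr0n !add0r sqr_lt1.
case/and5P=> /eqP z12 /eqP z13 /eqP z23 /eqP z24 /eqP z34.
have [PDS d] := PD1S; exists (S v1 v4); split; first by rewrite -sqr_lt1 PD1_sqr_lt1.
by rewrite [LHS]mx4_eta !(PD_symE PDS) !d z12 z13 z23 z24 z34.
Qed.

(** Positive definiteness is part of the parametrization here, so no sum of squares is called
    for. *)
Lemma such_star3 : [set S | exists s12 s13 s14 : R,
    let s23 := s12 * s13 / (1 - s14 ^+ 2) in
    S = mx4 [:: [:: 1; s12; s13; s14]; [:: s12; 1; s23; 0];
                [:: s13; s23; 1; 0]; [:: s14; 0; 0; 1]] /\ PD R 4 S] =
  PD1_such (fun S => [&& S v2 v4 == 0, S v3 v4 == 0
    & S v2 v3 == S v1 v2 * S v1 v3 / (1 - S v1 v4 ^+ 2)]).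
Proof.
apply/seteqP; split=> [S [a [b [c /= [E PDS]]]]|S [PD1S /and3P[/eqP z24 /eqP z34 /eqP z23]]].
  rewrite E in PDS *; split; last by rewrite !mxE /= !eqxx.
  by apply: PD1_mx4; last by split; rewrite mxE.
have [PDS d] := PD1S; exists (S v1 v2), (S v1 v3), (S v1 v4); split=> //.
by rewrite [LHS]mx4_eta !(PD_symE PDS) !d z24 z34 z23.
Qed.
End UnitCases.

(** * Models with unit diagonal *)

Section ModelCases.
Variable R : realType.

Lemma double_markov1_sub (G H : {set {set 'I_4}}) (b : 'M[R]_4 -> bool) :
  (forall S, double_markov R G H S <-> PD R 4 S /\ b S) ->
  double_markov1 R G H = PD1_such b.
Proof.
by move=> Hb; apply/seteqP; split=> S [] => [/Hb[? ?] ?|[? ?] ?]; split=> //; apply/Hb.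
Qed.

Ltac by_zeros1 := apply: eq_PD1_such => S _; rewrite /= ?mulf_eq0;
  case: (S v1 v2 == 0); case: (S v1 v3 == 0); case: (S v1 v4 == 0);
  case: (S v2 v3 == 0); case: (S v2 v4 == 0); case: (S v3 v4 == 0).

Lemma star_case2 : double_markov1 R (K4 :\ e23)%SET S4 =
  PD1_such (fun S => [&& S v1 v2 == 0, S v2 v3 == 0, S v2 v4 == 0 & S v3 v4 == 0])
  `|`
  PD1_such (fun S => [&& S v1 v3 == 0, S v2 v3 == 0, S v2 v4 == 0 & S v3 v4 == 0]).
Proof.
rewrite (double_markov1_sub (fun S =>
  @double_markov_S4 R _ false true true S _)) ?codeE //.
by rewrite PD1_suchU; by_zeros1.
Qed.

Lemma star_case4 : double_markov1 R (K4 :\: [set e23; e24])%SET S4 =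
  PD1_such (fun S => [&& S v1 v3 == 0, S v1 v4 == 0, S v2 v3 == 0, S v2 v4 == 0
    & S v3 v4 == 0])
  `|`
  PD1_such (fun S => [&& S v1 v2 == 0, S v2 v3 == 0, S v2 v4 == 0 & S v3 v4 == 0]).
Proof.
rewrite (double_markov1_sub (fun S =>
  @double_markov_S4 R _ false false true S _)) ?codeE //.
by rewrite PD1_suchU; by_zeros1.
Qed.

Lemma star_case6 : double_markov1 R S4 S4 =
  PD1_such (fun S => [&& S v1 v3 == 0, S v1 v4 == 0, S v2 v3 == 0, S v2 v4 == 0
    & S v3 v4 == 0])
  `|`
  PD1_such (fun S => [&& S v1 v2 == 0, S v1 v4 == 0, S v2 v3 == 0, S v2 v4 == 0
    & S v3 v4 == 0])
  `|`
  PD1_such (fun S => [&& S v1 v2 == 0, S v1 v3 == 0, S v2 v3 == 0, S v2 v4 == 0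
    & S v3 v4 == 0]).
Proof.
rewrite (double_markov1_sub (fun S =>
  @double_markov_S4 R _ false false false S _)) ?codeE //.
by rewrite !PD1_suchU; by_zeros1.
Qed.

Lemma path_case7 : double_markov1 R (K4 :\ e13)%SET (e13 |: P4)%SET =
  PD1_such (fun S =>
    [&& S v1 v4 == 0, S v2 v4 == 0 & S v1 v3 == S v1 v2 * S v2 v3]).
Proof.
rewrite double_markov1E; apply: eq_PD1_such => S [PDS d].
rewrite /zeros !codeE /= !andbT -!andbA.
case: eqP => //= z14; case: eqP => //= z24.
rewrite -[RHS]subr_eq0; congr (_ == _).
by rewrite /partial_cov !(PD_symE PDS) !d z14 z24; ring.
Qed.

(** The minor for 14 is [- S34] times the minor for 13, so removing 14 as well adds no condition. *)
Lemma path_case8 : double_markov1 R (K4 :\: [set e13; e14])%SET (e13 |: P4)%SET =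
  PD1_such (fun S =>
    [&& S v1 v4 == 0, S v2 v4 == 0 & S v1 v3 == S v1 v2 * S v2 v3]).
Proof.
rewrite double_markov1E; apply: eq_PD1_such => S [PDS d].
rewrite /zeros !codeE /= !andbT -!andbA.
case: eqP => //= z14; case: eqP => //= z24.
have -> : partial_cov S v1 v3 v2 v4 = S v1 v3 - S v1 v2 * S v2 v3.
  by rewrite /partial_cov !(PD_symE PDS) !d z14 z24; ring.
have -> : partial_cov S v1 v4 v2 v3 = - S v3 v4 * (S v1 v3 - S v1 v2 * S v2 v3).
  by rewrite /partial_cov !(PD_symE PDS) !d z14 z24; ring.
by rewrite mulf_eq0 subr_eq0; case: eqP; rewrite ?orbT.
Qed.

Lemma path_case9 : double_markov1 R (K4 :\: [set e13; e24])%SET (e13 |: P4)%SET =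
  PD1_such (fun S => [&& S v1 v3 == 0, S v1 v4 == 0, S v2 v3 == 0 & S v2 v4 == 0])
  `|`
  PD1_such (fun S => [&& S v1 v4 == 0, S v2 v4 == 0, S v3 v4 == 0
    & S v1 v3 == S v1 v2 * S v2 v3]).
Proof.
rewrite double_markov1E PD1_suchU; apply: eq_PD1_such => S PD1S.
have [PDS d] := PD1S; rewrite /zeros !codeE /= !andbT -!andbA.
case: eqP => /= z14; last by rewrite !andbF.
case: eqP => /= z24; last by rewrite !andbF.
have -> : partial_cov S v1 v3 v2 v4 = S v1 v3 - S v1 v2 * S v2 v3.
  by rewrite /partial_cov !(PD_symE PDS) !d z14 z24; ring.
have -> : partial_cov S v2 v4 v1 v3 = S v3 v4 * (S v1 v2 * S v1 v3 - S v2 v3).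
  by rewrite /partial_cov !(PD_symE PDS) !d z14 z24; ring.
have /lt_eqF a1 := PD1_sqr_lt1 PD1S (isT : v1 != v2).
rewrite subr_eq0 andbT; have [->|n13] := eqVneq (S v1 v3) (S v1 v2 * S v2 v3).
  (* After substituting [S13], the minor for 24 is [S34 (S12^2 - 1) S23], whose middle factor is
     nonzero. *)
  rewrite mulrA -expr2 -[X in _ - X]mul1r -mulrBl !mulf_eq0 subr_eq0 a1 /=.
  by case: (S v2 v3 == 0); rewrite ?orbT ?orbF ?andbF ?andbT.
rewrite andbF orbF; apply/esym/andP => -[/eqP z13 /eqP z23].
by rewrite z13 z23 mulr0 eqxx in n13.
Qed.

Lemma path_case10 : double_markov1 R (K4 :\ e14)%SET (e14 |: P4)%SET =
  PD1_such (fun S => [&& S v1 v3 == 0, S v2 v4 == 0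
    & S v1 v4 == - (S v1 v2 * S v2 v3 * S v3 v4) / (1 - S v2 v3 ^+ 2)]).
Proof.
rewrite double_markov1E; apply: eq_PD1_such => S PD1S.
have [PDS d] := PD1S; rewrite /zeros !codeE /= !andbT -!andbA.
case: eqP => //= z13; case: eqP => //= z24.
have := PD1_sqr_lt1 PD1S (isT : v2 != v3); rewrite -subr_gt0 => /lt0r_neq0 k.
rewrite -[RHS](inj_eq (mulIf k)) divfK // -[RHS]subr_eq0.
by congr (_ == _); rewrite /partial_cov !(PD_symE PDS) !d z13 z24; ring.
Qed.

Lemma path_case11 : double_markov1 R (K4 :\: [set e13; e14])%SET (e14 |: P4)%SET =
  PD1_such (fun S => [&& S v1 v3 == 0, S v1 v4 == 0, S v2 v3 == 0 & S v2 v4 == 0])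
  `|`
  PD1_such (fun S => [&& S v1 v2 == 0, S v1 v3 == 0, S v1 v4 == 0 & S v2 v4 == 0]).
Proof.
rewrite double_markov1E PD1_suchU; apply: eq_PD1_such => S PD1S.
have [PDS d] := PD1S; rewrite /zeros !codeE /= !andbT -!andbA.
case: eqP => /= z13; last by rewrite !andbF.
case: eqP => /= z24; last by rewrite !andbF.
have E13 : partial_cov S v1 v3 v2 v4 = - (S v1 v2 * S v2 v3) - S v1 v4 * S v3 v4.
  by rewrite /partial_cov !(PD_symE PDS) !d z13 z24; ring.
have E14 : partial_cov S v1 v4 v2 v3
    = S v1 v4 * (1 - S v2 v3 ^+ 2) + S v1 v2 * S v2 v3 * S v3 v4.
  by rewrite /partial_cov !(PD_symE PDS) !d z13 z24; ring.
have lt1 := PD1_sqr2_lt1 PD1S (isT : uniq [:: v3; v2; v4]) z24.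
rewrite (PD_symE PDS) in lt1.
have -> : (partial_cov S v1 v3 v2 v4 == 0) && (partial_cov S v1 v4 v2 v3 == 0)
    = (S v1 v4 == 0) && (S v1 v2 * S v2 v3 == 0).
  rewrite E13 E14; apply/andP/andP => [[/eqP p /eqP q]|[/eqP z14 /eqP p]]; last first.
    by rewrite z14 p !mul0r oppr0 !addr0.
  have z14 : S v1 v4 = 0.
    (* Adding [S34] times the minor for 13 to the minor for 14 cancels [S12 S23 S34]; the remaining
       factor is the principal minor on 2, 3, 4. *)
    have : S v1 v4 * (1 - (S v2 v3 ^+ 2 + S v3 v4 ^+ 2)) = 0.
      by rewrite -[RHS]q -[RHS]addr0 -(mulr0 (S v3 v4)) -[in RHS]p; ring.
    by move/eqP; rewrite mulf_eq0 subr_eq0 [_ == _ + _]gt_eqF // orbF => /eqP.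
  by move: p; rewrite z14 mul0r subr0 => /eqP; rewrite oppr_eq0 eqxx.
rewrite mulf_eq0; case: (S v1 v4 == 0) => //=; last by rewrite andbF.
by rewrite orbC !andbT.
Qed.

Lemma star_case3 : double_markov1 R (K4 :\ e23)%SET (e23 |: S4)%SET =
  PD1_such (fun S => [&& S v2 v4 == 0, S v3 v4 == 0
    & S v2 v3 == S v1 v2 * S v1 v3 / (1 - S v1 v4 ^+ 2)]).
Proof.
rewrite double_markov1E; apply: eq_PD1_such => S PD1S.
have [PDS d] := PD1S; rewrite /zeros !codeE /= !andbT -!andbA.
case: eqP => //= z24; case: eqP => //= z34.
have := PD1_sqr_lt1 PD1S (isT : v1 != v4); rewrite -subr_gt0 => /lt0r_neq0 k.
rewrite -[RHS](inj_eq (mulIf k)) divfK // -[RHS]subr_eq0.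
by congr (_ == _); rewrite /partial_cov !(PD_symE PDS) !d z24 z34; ring.
Qed.

Lemma star_case5 : double_markov1 R (K4 :\: [set e23; e24])%SET (e23 |: S4)%SET =
  PD1_such (fun S => [&& S v1 v4 == 0, S v2 v4 == 0, S v3 v4 == 0
    & S v2 v3 == S v1 v2 * S v1 v3])
  `|`
  PD1_such (fun S => [&& S v1 v2 == 0, S v2 v3 == 0, S v2 v4 == 0 & S v3 v4 == 0]).
Proof.
rewrite double_markov1E PD1_suchU; apply: eq_PD1_such => S PD1S.
have [PDS d] := PD1S; rewrite /zeros !codeE /= !andbT -!andbA.
case: eqP => /= z24; last by rewrite !andbF.
case: eqP => /= z34; last by rewrite !andbF.
have -> : partial_cov S v2 v3 v1 v4 = S v2 v3 * (1 - S v1 v4 ^+ 2) - S v1 v2 * S v1 v3.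
  by rewrite /partial_cov !(PD_symE PDS) !d z24 z34; ring.
have -> : partial_cov S v2 v4 v1 v3 = S v1 v4 * (S v1 v3 * S v2 v3 - S v1 v2).
  by rewrite /partial_cov !(PD_symE PDS) !d z24 z34; ring.
have lt1 := PD1_sqr2_lt1 PD1S (isT : uniq [:: v1; v3; v4]) z34.
rewrite mulf_eq0 !subr_eq0 !andbT.
have [z14|nz14] := eqVneq (S v1 v4) 0.
  (* For [S14 = 0] only [S23 = S12 S13] remains, and the matrices of the disc with [S14 = 0] already
     satisfy it. *)
  rewrite z14 expr0n subr0 mulr1 /= andbT; apply/esym/orb_idr => /andP[/eqP-> /eqP->].
  by rewrite mul0r.
rewrite /=; apply/andP/andP => [[/eqP p /eqP q]|[/eqP-> /eqP->]]; last first.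
  by rewrite mulr0 !mul0r eqxx.
suff z23 : S v2 v3 = 0 by rewrite -q z23 mulr0.
(* For [S14] nonzero the minor for 24 gives [S12 = S13 S23]; inserted into the minor for 23, this
   leaves [S23] times the principal minor on 1, 3, 4. *)
have : S v2 v3 * (1 - (S v1 v3 ^+ 2 + S v1 v4 ^+ 2)) = 0.
  by move: p; rewrite -q => p; apply/eqP; rewrite -subr_eq0 in p *; lra.
by move/eqP; rewrite mulf_eq0 subr_eq0 [_ == _ + _]gt_eqF // orbF => /eqP.
Qed.

End ModelCases.

Theorem proposition3p31 (R : realType) (n : nat) (G H : {set {set 'I_n}})
    (simpleG : simple_graph G) (simpleH : simple_graph H)
    (card3 : #|G :&: H| = 3%N) (conn : connected_on_support (G :&: H)) :
  (* shape of the intersection *)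
  [\/ exists i j k : 'I_n, uniq [:: i; j; k] /\ G :&: H = triangle i j k,
      exists i j k l : 'I_n, uniq [:: i; j; k; l] /\
        G :&: H = path_graph i j k l
    | exists i j k l : 'I_n, uniq [:: i; j; k; l] /\
        G :&: H = star_graph i j k l]
  /\ (forall i j k : 'I_n, uniq [:: i; j; k] -> G :&: H = triangle i j k ->
        double_markov R G H = padded [tuple i; j; k] (PD R 3))
  (* swapping G and H *)
  /\ double_markov R H G = inverses (double_markov R G H)
  (* restricting to four vertices *)
  /\ (forall i j k l : 'I_n, uniq [:: i; j; k; l] ->
        G :&: H = path_graph i j k l \/ G :&: H = star_graph i j k l ->
        let V := [tuple i; j; k; l] in
        double_markov R G H =
          padded V (double_markov R (induced V G) (induced V H)))
  (* up to symmetry and inversion, the cases below are exhaustive *)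
  /\ (forall i j k l : 'I_n, uniq [:: i; j; k; l] ->
        G :&: H = path_graph i j k l ->
        reduces_to R G H [:: i; j; k; l] path_cases)
  /\ (forall i j k l : 'I_n, uniq [:: i; j; k; l] ->
        G :&: H = star_graph i j k l ->
        reduces_to R G H [:: i; j; k; l] star_cases)
  (* paths *)
  /\ (let PD12_PD34 :=
        direct_sum [tuple v1; v2] [tuple v3; v4] (PD R 2) (PD R 2) in
      let PD12_PD34_1 :=
        direct_sum [tuple v1; v2] [tuple v3; v4] (PD1 R 2) (PD1 R 2) in
      let PD23 := padded [tuple v2; v3] (PD R 2) in
      double_markov R K4 P4 = markov_inv R (K4 :&: P4)
   /\ double_markov R (K4 :\ e13)%SET P4 =
        PD12_PD34 `|` markov_inv R [set e23; e34]%SET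
   /\ double_markov R (K4 :\ e14)%SET P4 =
        PD12_PD34 `|` markov_inv R [set e12; e23]%SET
                  `|` markov_inv R [set e23; e34]%SET
      (* for S supported on the path, (S^-1)_13 = 0 forces S_12 * S_23 = 0, so the
         set M({12,23})^-1 does not occur *)
   /\ double_markov R (K4 :\: [set e13; e14])%SET P4 =
        PD12_PD34 `|` markov_inv R [set e23; e34]%SET
   /\ double_markov R (K4 :\: [set e13; e24])%SET P4 = PD12_PD34 `|` PD23
   /\ double_markov R P4 P4 = PD12_PD34 `|` PD23
   /\ double_markov1 R (K4 :\ e13)%SET (e13 |: P4)%SET =
        [set S | exists s12 s23 s34 : R,
          [/\ -1 < s12 < 1, s23 ^+ 2 + s34 ^+ 2 < 1 &
            S = mx4 [:: [:: 1; s12; s12 * s23; 0];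
                        [:: s12; 1; s23; 0];
                        [:: s12 * s23; s23; 1; s34];
                        [:: 0; 0; s34; 1]]]]
   /\ double_markov1 R (K4 :\: [set e13; e14])%SET (e13 |: P4)%SET =
        [set S | exists s12 s23 s34 : R,
          [/\ -1 < s12 < 1, s23 ^+ 2 + s34 ^+ 2 < 1 &
            S = mx4 [:: [:: 1; s12; s12 * s23; 0];
                        [:: s12; 1; s23; 0];
                        [:: s12 * s23; s23; 1; s34];
                        [:: 0; 0; s34; 1]]]]
   /\ double_markov1 R (K4 :\: [set e13; e24])%SET (e13 |: P4)%SET =
        PD12_PD34_1 `|`
        [set S | exists s12 s23 : R,
          [/\ -1 < s12 < 1, -1 < s23 < 1 &
            S = mx4 [:: [:: 1; s12; s12 * s23; 0];
                        [:: s12; 1; s23; 0];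
                        [:: s12 * s23; s23; 1; 0];
                        [:: 0; 0; 0; 1]]]]
   /\ double_markov1 R (K4 :\ e14)%SET (e14 |: P4)%SET =
        [set S | exists s12 s23 s34 : R,
          let s14 := - (s12 * s23 * s34) / (1 - s23 ^+ 2) in
          [/\ s12 ^+ 2 + s23 ^+ 2 < 1, s23 ^+ 2 + s34 ^+ 2 < 1 &
            S = mx4 [:: [:: 1; s12; 0; s14];
                        [:: s12; 1; s23; 0];
                        [:: 0; s23; 1; s34];
                        [:: s14; 0; s34; 1]]]]
   /\ double_markov1 R (K4 :\: [set e13; e14])%SET (e14 |: P4)%SET =
        PD12_PD34_1 `|`
        [set S | exists s23 s34 : R,
          s23 ^+ 2 + s34 ^+ 2 < 1 /\
            S = mx4 [:: [:: 1; 0; 0; 0];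
                        [:: 0; 1; s23; 0];
                        [:: 0; s23; 1; s34];
                        [:: 0; 0; s34; 1]]])
  (* stars *)
  /\ (double_markov R K4 S4 = markov_inv R (K4 :&: S4)
   /\ (let disc13_14 :=
          [set S | exists s13 s14 : R,
            s13 ^+ 2 + s14 ^+ 2 < 1 /\
              S = mx4 [:: [:: 1; 0; s13; s14];
                          [:: 0; 1; 0; 0];
                          [:: s13; 0; 1; 0];
                          [:: s14; 0; 0; 1]]] in
        let disc12_14 :=
          [set S | exists s12 s14 : R,
            s12 ^+ 2 + s14 ^+ 2 < 1 /\
              S = mx4 [:: [:: 1; s12; 0; s14];
                          [:: s12; 1; 0; 0];
                          [:: 0; 0; 1; 0];
                          [:: s14; 0; 0; 1]]] in
        double_markov1 R (K4 :\ e23)%SET S4 = disc13_14 `|` disc12_14 /\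
        disc13_14 `&` disc12_14 =
          [set S | exists s14 : R,
            -1 < s14 < 1 /\
              S = mx4 [:: [:: 1; 0; 0; s14];
                          [:: 0; 1; 0; 0];
                          [:: 0; 0; 1; 0];
                          [:: s14; 0; 0; 1]]])
   /\ double_markov1 R (K4 :\ e23)%SET (e23 |: S4)%SET =
        [set S | exists s12 s13 s14 : R,
          let s23 := s12 * s13 / (1 - s14 ^+ 2) in
          S = mx4 [:: [:: 1; s12; s13; s14];
                      [:: s12; 1; s23; 0];
                      [:: s13; s23; 1; 0];
                      [:: s14; 0; 0; 1]] /\ PD R 4 S]
   /\ double_markov1 R (K4 :\: [set e23; e24])%SET S4 =
        [set S | exists s12 : R,
          -1 < s12 < 1 /\
            S = mx4 [:: [:: 1; s12; 0; 0];
                        [:: s12; 1; 0; 0];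
                        [:: 0; 0; 1; 0];
                        [:: 0; 0; 0; 1]]] `|`
        [set S | exists s13 s14 : R,
          s13 ^+ 2 + s14 ^+ 2 < 1 /\
            S = mx4 [:: [:: 1; 0; s13; s14];
                        [:: 0; 1; 0; 0];
                        [:: s13; 0; 1; 0];
                        [:: s14; 0; 0; 1]]]
   /\ double_markov1 R (K4 :\: [set e23; e24])%SET (e23 |: S4)%SET =
        [set S | exists s12 s13 : R,
          [/\ -1 < s12 < 1, -1 < s13 < 1 &
            S = mx4 [:: [:: 1; s12; s13; 0];
                        [:: s12; 1; s12 * s13; 0];
                        [:: s13; s12 * s13; 1; 0];
                        [:: 0; 0; 0; 1]]]] `|`
        [set S | exists s13 s14 : R,
          s13 ^+ 2 + s14 ^+ 2 < 1 /\
            S = mx4 [:: [:: 1; 0; s13; s14];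
                        [:: 0; 1; 0; 0];
                        [:: s13; 0; 1; 0];
                        [:: s14; 0; 0; 1]]]
   /\ double_markov1 R S4 S4 =
        [set S | exists s12 : R,
          -1 < s12 < 1 /\
            S = mx4 [:: [:: 1; s12; 0; 0];
                        [:: s12; 1; 0; 0];
                        [:: 0; 0; 1; 0];
                        [:: 0; 0; 0; 1]]] `|`
        [set S | exists s13 : R,
          -1 < s13 < 1 /\
            S = mx4 [:: [:: 1; 0; s13; 0];
                        [:: 0; 1; 0; 0];
                        [:: s13; 0; 1; 0];
                        [:: 0; 0; 0; 1]]] `|`
        [set S | exists s14 : R,
          -1 < s14 < 1 /\
            S = mx4 [:: [:: 1; 0; 0; s14];
                        [:: 0; 1; 0; 0];
                        [:: 0; 0; 1; 0];
                        [:: s14; 0; 0; 1]]]).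
Proof.
have simpleGH : simple_graph (G :&: H).
  by move=> e; rewrite finset.in_setI => /andP[/simpleG].
split; first exact: connected3_shape.
split.
  move=> i j k uV GH.
  apply: double_markov_clique => //; first by rewrite GH; apply: cover_triangle.
  move=> s t; rewrite GH !inE !edge_eq.
  by move=> /or3P[] /eqP-> /or3P[] /eqP->; rewrite !eqxx ?orbT.
split; first exact: double_markovC.
split.
  move=> i j k l uV GH; apply: double_markov_padded => //.
  by case: GH => ->; [apply: cover_path|apply: cover_star].
split; first by move=> i j k l; apply: reduces_path.
split; first by move=> i j k l; apply: reduces_star.
split.
  split; first exact: double_markov_K4.
  split; first exact: path_case2.
  split; first exact: path_case3.
  split; first exact: path_case4.
  split; first exact: path_case5.
  split; first exact: path_case6.
  rewrite tree_pathE triangle12_23E cycleE disc23_34E such_PD1_12_34.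
  split; first exact: path_case7.
  split; first exact: path_case8.
  split; first exact: path_case9.
  split; first exact: path_case10.
  exact: path_case11.
rewrite disc13_14E disc12_14E triangle12_13E.
rewrite segment12E segment13E segment14E such_star3.
split; first exact: double_markov_K4.
split.
  split; first exact: star_case2.
  (* The segment is cut out by the union of the vanishing conditions of the two discs. *)
  rewrite PD1_suchI; apply: eq_PD1_such => S _.
  case: (S v1 v2 == 0); case: (S v1 v3 == 0); case: (S v2 v3 == 0);
  by case: (S v2 v4 == 0); case: (S v3 v4 == 0).
split; first exact: star_case3.
split; first exact: star_case4.
split; first exact: star_case5.
exact: star_case6.
Qed.
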